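(* Let $\Omega\subseteq\mathbb{C}$ be open and let $\omega:\Omega\to\mathbb{C}$ be a holomorphic function such that $\operatorname{Im}\omega(k)\le|\operatorname{Im} k|$ for all $k\in\Omega$. Then $\omega$ has no poles and no essential singularities; that is, if $a\in\mathbb{C}\setminus\Omega$ is such that $\{k\in\mathbb{C}:0<|k-a|<\rho\}\subseteq\Omega$ for some $\rho>0$, then $a$ is neither a pole nor an (isolated) essential singularity of $\omega$.
   Context: Only isolated singularities are considered. *)

(* Defs.v *)
From Stdlib Require Import Reals.
From Coquelicot Require Import Coquelicot.
Open Scope R_scope.

(* A function Omega -> C is represented by a total function f : C -> C whose
   values outside Omega are irrelevant. *)

Definition holomorphic_on (Omega : C -> Prop) (f : C -> C) : Prop :=
  forall z : C, Omega z -> @ex_derive C_AbsRing C_NormedModule f z.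

Definition disc (a : C) (rho : R) (z : C) : Prop := Cmod (z - a)%C < rho.

Definition punctured_disc (a : C) (rho : R) (z : C) : Prop :=
  0 < Cmod (z - a)%C < rho.

Definition isolated_point (Omega : C -> Prop) (a : C) : Prop :=
  ~ Omega a /\
  exists rho : R, 0 < rho /\
    forall z : C, punctured_disc a rho z -> Omega z.

(* In the three definitions below f is meant to be holomorphic on the open set
   Omega; its isolated singularities are then the points a with
   isolated_point Omega a. *)

Definition is_removable (Omega : C -> Prop) (f : C -> C) (a : C) : Prop :=
  isolated_point Omega a /\
  exists (rho : R) (g : C -> C),
    0 < rho /\
    holomorphic_on (disc a rho) g /\
    forall z : C, punctured_disc a rho z -> Omega z /\ g z = f z.

Definition is_pole (Omega : C -> Prop) (f : C -> C) (a : C) : Prop :=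
  isolated_point Omega a /\
  filterlim (fun z : C => Cmod (f z)) (locally' a) (Rbar_locally p_infty).

Definition is_essential (Omega : C -> Prop) (f : C -> C) (a : C) : Prop :=
  isolated_point Omega a /\
  ~ is_removable Omega f a /\ ~ is_pole Omega f a.

(* Main.v *)
Require Import Defs.
From Stdlib Require Import Reals Lra ClassicalEpsilon.
From Coquelicot Require Import Coquelicot.
Open Scope R_scope.

(* With Im omega <= M near a, the function h = 1/(omega - i(M+1)) is bounded
   near a and Im h > 0. By Riemann's theorem h extends holomorphically to a, and
   the mean value property gives Im h(a) > 0, so h(a) <> 0 and
   omega = 1/h + i(M+1) extends holomorphically to a as well.

   Riemann's theorem comes from the third-order Taylor expansion at 0 of
   z^2 h(a + z), hence from Cauchy's formula. That is reduced to homotopy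
   invariance of integrals over circles, which is Goursat's bisection argument
   carried out in the parameter rectangle of the homotopy. *)

(** A one-sided bound is enough because it confines omega to a half-plane, which w -> 1/(w - i(M+1))
    carries into a bounded disc of the upper half-plane. Since |Im k| is bounded near a, such an M
    exists. Strict positivity at the centre is the point of the mean value step: a zero of h at a
    would be a pole of omega. The order three is forced by what has to be read off: after division
    of z^2 h(a + z) by z^2, the coefficients of order two and three become the value and the
    derivative of the extension at a, and the fourth-order remainder becomes O(z^2), which is
    negligible against z. No convergent power series is required. The bisection takes place in the
    parameter rectangle because the region swept by a moving circle is not convex and the integrand
    may be singular inside it. After pulling back along the homotopy only rectangles are cut, and
    the plane geometry is reduced to bounds on the homotopy and its partial derivatives. *)

Local Notation Cnhds := (@locally C_UniformSpace).

(** * Moduli and neighbourhoods in the complex plane *)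

Lemma Cmod_minus_sym (x y : C) : Cmod (x - y) = Cmod (y - x).
Proof. rewrite <- Cmod_opp; f_equal; ring. Qed.

Lemma Cmod_triangle_minus (x y : C) : Cmod (x - y) <= Cmod x + Cmod y.
Proof. rewrite <- (Cmod_opp y); apply Cmod_triangle. Qed.

Lemma Cmod_triangle_rev (x y : C) : Cmod x - Cmod y <= Cmod (x - y).
Proof.
  generalize (Cmod_triangle (x - y) y).
  replace (x - y + y)%C with x by ring. lra.
Qed.

Lemma im_le_Cmod (c : C) : Rabs (Im c) <= Cmod c.
Proof. exact (Rle_trans _ _ _ (Rmax_r _ _) (Rmax_Cmod c)). Qed.

Lemma Cmod_le_Re_Im (c : C) : Cmod c <= Rabs (Re c) + Rabs (Im c).
Proof.
  destruct c as [u v]; simpl.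
  replace (u, v) with (RtoC u + v * Ci)%C
    by (unfold RtoC, Ci, Cplus, Cmult; simpl; f_equal; ring).
  eapply Rle_trans; [apply Cmod_triangle|].
  rewrite Cmod_mult, !Cmod_R, Cmod_Ci. lra.
Qed.

Lemma Cminus_neq_0 (x y : C) : x <> y -> (x - y)%C <> 0.
Proof.
  intros H E; apply H. replace x with (x - y + y)%C by ring. rewrite E. ring.
Qed.

Lemma Cmod_minus_gt_0 (x y : C) : 0 < Cmod (x - y) -> x <> y.
Proof.
  intros H E; rewrite E in H. replace (y - y)%C with (RtoC 0) in H by ring.
  rewrite Cmod_0 in H. lra.
Qed.

(** The balls of [C_UniformSpace] are squares. A square of half-side d / sqrt 2 fits into the disc
    of radius d, which gives the backward direction. *)
Lemma locally_CP (z : C) (P : C -> Prop) :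
  Cnhds z P <->
  exists d, 0 < d /\ forall w, Cmod (w - z) < d -> P w.
Proof.
  split.
  - intros [d H]. exists d; split; [apply cond_pos|].
    intros w Hw; apply H. now apply C_NormedModule_mixin_compat1.
  - intros (d & Hd & H).
    assert (Hd' : 0 < d / sqrt 2).
    { apply Rdiv_lt_0_compat; [easy|]. apply sqrt_lt_R0; lra. }
    exists (mkposreal _ Hd'). intros w Hw. apply H.
    eapply Rlt_le_trans; [exact (C_NormedModule_mixin_compat2 z w _ Hw)|].
    simpl. right. field. apply Rgt_not_eq, sqrt_lt_R0; lra.
Qed.

(** * Limits of complex-valued functions along a filter *)

(** The filter is a parameter, so that the same rules serve limits at a complex point and limits in
    a real parameter. The non-strict bound matches the first-order estimate in [cdiff_slope]. *)
Definition tends {T : Type} (F : (T -> Prop) -> Prop) (f : T -> C) (l : C) : Prop :=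
  forall eps, 0 < eps -> F (fun x => Cmod (f x - l) <= eps).

Section Limits.
Context {T : Type} (F : (T -> Prop) -> Prop) {FF : Filter F}.

Lemma tends_const (c : C) : tends F (fun _ => c) c.
Proof.
  intros eps He. apply filter_forall; intros _.
  replace (c - c)%C with (RtoC 0) by ring. rewrite Cmod_0. lra.
Qed.

Lemma tends_plus (f g : T -> C) (l m : C) :
  tends F f l -> tends F g m -> tends F (fun x => f x + g x)%C (l + m).
Proof.
  intros Hf Hg eps He.
  generalize (@filter_and _ F FF _ _ (Hf (eps/2) ltac:(lra)) (Hg (eps/2) ltac:(lra))).
  apply filter_imp; intros x [H1 H2].
  replace (f x + g x - (l + m))%C with ((f x - l) + (g x - m))%C by ring.
  eapply Rle_trans; [apply Cmod_triangle|]. lra.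
Qed.

Lemma tends_mult (f g : T -> C) (l m : C) :
  tends F f l -> tends F g m -> tends F (fun x => f x * g x)%C (l * m).
Proof.
  intros Hf Hg eps He.
  pose proof (Cmod_ge_0 l) as Hl. pose proof (Cmod_ge_0 m) as Hm.
  (* With both errors at most d <= 1, the three terms of the expanded difference add up to at most d
     * (1 + Cmod l + Cmod m). *)
  set (d := Rmin 1 (eps / (1 + Cmod l + Cmod m))).
  assert (Hd : 0 < d).
  { apply Rmin_glb_lt; [lra|]. apply Rdiv_lt_0_compat; lra. }
  assert (Hd1 : d <= 1) by apply Rmin_l.
  assert (Hd2 : d * (1 + Cmod l + Cmod m) <= eps).
  { replace eps with (eps / (1 + Cmod l + Cmod m) * (1 + Cmod l + Cmod m))
      by (field; lra).
    apply Rmult_le_compat_r; [lra|apply Rmin_r]. }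
  generalize (@filter_and _ F FF _ _ (Hf d Hd) (Hg d Hd)).
  apply filter_imp; intros x [H1 H2].
  replace (f x * g x - l * m)%C
    with ((f x - l) * (g x - m) + (f x - l) * m + l * (g x - m))%C by ring.
  eapply Rle_trans; [apply Cmod_triangle|].
  eapply Rle_trans; [apply Rplus_le_compat_r, Cmod_triangle|].
  rewrite !Cmod_mult.
  pose proof (Cmod_ge_0 (f x - l)). pose proof (Cmod_ge_0 (g x - m)). nra.
Qed.

Lemma tends_opp (f : T -> C) (l : C) : tends F f l -> tends F (fun x => - f x)%C (- l).
Proof.
  intros Hf eps He. generalize (Hf eps He); apply filter_imp; intros x H.
  replace (- f x - - l)%C with (- (f x - l))%C by ring. now rewrite Cmod_opp.
Qed.

Lemma tends_minus (f g : T -> C) (l m : C) :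
  tends F f l -> tends F g m -> tends F (fun x => f x - g x)%C (l - m).
Proof. intros Hf Hg. apply tends_plus; [easy|now apply tends_opp]. Qed.

Lemma tends_inv (f : T -> C) (l : C) :
  l <> 0 -> tends F f l -> tends F (fun x => / f x)%C (/ l).
Proof.
  intros Hl Hf eps He.
  assert (Hl' : 0 < Cmod l) by now apply Cmod_gt_0.
  (* The first bound keeps Cmod (f x) above Cmod l / 2; with this the second makes the quotient at
     most eps. *)
  set (d := Rmin (Cmod l / 2) (eps * (Cmod l * Cmod l) / 2)).
  assert (Hd : 0 < d).
  { apply Rmin_glb_lt; [lra|]. apply Rdiv_lt_0_compat; [|lra].
    repeat apply Rmult_lt_0_compat; lra. }
  generalize (Hf d Hd); apply filter_imp; intros x H.
  assert (H1 : Cmod (f x - l) <= Cmod l / 2) by (eapply Rle_trans; [exact H|apply Rmin_l]).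
  assert (H2 : Cmod (f x - l) <= eps * (Cmod l * Cmod l) / 2)
    by (eapply Rle_trans; [exact H|apply Rmin_r]).
  assert (H3 : Cmod l / 2 <= Cmod (f x)).
  { pose proof (Cmod_triangle_rev l (f x)) as H3. rewrite Cmod_minus_sym in H3. lra. }
  assert (Hfx : f x <> 0) by (apply Cmod_gt_0; lra).
  replace (/ f x - / l)%C with (- (f x - l) / (f x * l))%C by now field.
  rewrite Cmod_div, Cmod_opp, Cmod_mult by now apply Cmult_neq_0.
  apply Rle_div_l; [apply Rmult_lt_0_compat; lra|].
  eapply Rle_trans; [exact H2|].
  replace (eps * (Cmod l * Cmod l) / 2) with (eps * (Cmod l / 2 * Cmod l)) by field.
  apply Rmult_le_compat_l; [lra|]. apply Rmult_le_compat_r; lra.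
Qed.

Lemma tends_comp (f : C -> C) (g : T -> C) (z l : C) :
  tends (Cnhds z) f l -> tends F g z -> tends F (fun x => f (g x)) l.
Proof.
  intros Hf Hg eps He.
  specialize (Hf eps He). apply locally_CP in Hf as (d & Hd & H).
  generalize (Hg (d/2) ltac:(lra)); apply filter_imp; intros x Hx.
  apply H. lra.
Qed.

Lemma tends_pair (u v : T -> R) (l m : R) :
  filterlim u F (locally l) -> filterlim v F (locally m) ->
  tends F (fun x => (u x, v x)) (l, m).
Proof.
  intros Hu Hv eps He.
  assert (He' : 0 < eps / 2) by lra.
  generalize (@filter_and _ F FF _ _ (proj1 (filterlim_locally u l) Hu (mkposreal _ He'))
                             (proj1 (filterlim_locally v m) Hv (mkposreal _ He'))).
  apply filter_imp; intros x [H1 H2].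
  change (Rabs (u x - l) < eps / 2) in H1. change (Rabs (v x - m) < eps / 2) in H2.
  eapply Rle_trans; [apply Cmod_le_Re_Im|]. simpl.
  unfold Rminus in *. lra.
Qed.

Lemma tends_Re (f : T -> C) (l : C) :
  tends F f l -> filterlim (fun x => Re (f x)) F (locally (Re l)).
Proof.
  intros Hf. apply filterlim_locally; intros [eps He].
  generalize (Hf (eps/2) ltac:(lra)); apply filter_imp; intros x H.
  change (Rabs (Re (f x - l)) < eps).
  eapply Rle_lt_trans; [apply re_le_Cmod|lra].
Qed.

Lemma tends_Im (f : T -> C) (l : C) :
  tends F f l -> filterlim (fun x => Im (f x)) F (locally (Im l)).
Proof.
  intros Hf. apply filterlim_locally; intros [eps He].
  generalize (Hf (eps/2) ltac:(lra)); apply filter_imp; intros x H.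
  change (Rabs (Im (f x - l)) < eps).
  eapply Rle_lt_trans; [apply im_le_Cmod|lra].
Qed.

End Limits.

Lemma tends_id (z : C) : tends (Cnhds z) (fun w => w) z.
Proof. intros eps He. apply locally_CP. exists eps; split; [easy|intros; lra]. Qed.

(** * Complex differentiability at a point *)

(* Caratheodory's form of complex differentiability. *)
Definition cdiff (f : C -> C) (z : C) : Prop :=
  exists psi : C -> C,
    (forall w, f w = f z + psi w * (w - z))%C /\
    tends (Cnhds z) psi (psi z).

Lemma cdiff_tends (f : C -> C) (z : C) :
  cdiff f z -> tends (Cnhds z) f (f z).
Proof.
  intros (psi & E & H).
  assert (K : tends (Cnhds z) (fun w => f z + psi w * (w - z))%C
                (f z + psi z * (z - z))%C).
  { apply tends_plus; try apply locally_filter. apply tends_const, locally_filter.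
    apply tends_mult; try apply locally_filter; [easy|].
    apply tends_minus; try apply locally_filter; [apply tends_id|].
    apply tends_const, locally_filter. }
  intros eps He. generalize (K eps He). apply filter_imp; intros w Hw.
  now rewrite <- !E in Hw.
Qed.

Lemma cdiff_const (c z : C) : cdiff (fun _ => c) z.
Proof.
  exists (fun _ => 0); split; [intros; ring|apply tends_const, locally_filter].
Qed.

Lemma cdiff_id (z : C) : cdiff (fun w => w) z.
Proof.
  exists (fun _ => 1); split; [intros; ring|apply tends_const, locally_filter].
Qed.

Lemma cdiff_plus (f g : C -> C) (z : C) :
  cdiff f z -> cdiff g z -> cdiff (fun w => f w + g w)%C z.
Proof.
  intros (p & Ep & Hp) (q & Eq & Hq).
  exists (fun w => p w + q w)%C; split.
  - intros w. rewrite (Ep w), (Eq w). ring.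
  - now apply tends_plus; [apply locally_filter| |].
Qed.

Lemma cdiff_mult (f g : C -> C) (z : C) :
  cdiff f z -> cdiff g z -> cdiff (fun w => f w * g w)%C z.
Proof.
  intros (p & Ep & Hp) Hg. pose proof (cdiff_tends g z Hg) as Cg.
  destruct Hg as (q & Eq & Hq).
  exists (fun w => p w * g w + f z * q w)%C; split.
  - intros w. rewrite (Ep w), (Eq w). ring.
  - apply tends_plus; [apply locally_filter| |].
    + now apply tends_mult; [apply locally_filter| |].
    + apply tends_mult; [apply locally_filter| |easy]. apply tends_const, locally_filter.
Qed.

Lemma cdiff_minus (f g : C -> C) (z : C) :
  cdiff f z -> cdiff g z -> cdiff (fun w => f w - g w)%C z.
Proof.
  intros (p & Ep & Hp) (q & Eq & Hq).
  exists (fun w => p w - q w)%C; split.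
  - intros w. rewrite (Ep w), (Eq w). ring.
  - now apply tends_minus; [apply locally_filter| |].
Qed.

Lemma cdiff_shift (f : C -> C) (a z : C) :
  cdiff f (a + z) -> cdiff (fun w => f (a + w))%C z.
Proof.
  intros (p & Ep & Hp).
  exists (fun w => p (a + w))%C; split.
  - intros w. rewrite (Ep (a + w)%C). ring.
  - apply (tends_comp _ p (fun w => a + w)%C (a + z)%C); [easy|].
    apply tends_plus; [apply locally_filter| |apply tends_id].
    apply tends_const, locally_filter.
Qed.

Lemma tends_ext_loc {T : Type} (F : (T -> Prop) -> Prop) {FF : Filter F} (f g : T -> C) (l : C) :
  F (fun x => f x = g x) -> tends F f l -> tends F g l.
Proof.
  intros E H eps He. generalize (@filter_and _ F FF _ _ E (H eps He)).
  apply filter_imp; intros x [Ex Hx]. now rewrite <- Ex.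
Qed.

(** The difference quotient, completed by l at z, serves as slope function; the estimate is its
    continuity at z. *)
Lemma cdiff_slope (f : C -> C) (z l : C) :
  (forall eps, 0 < eps -> Cnhds z
     (fun w => Cmod (f w - f z - l * (w - z)) <= eps * Cmod (w - z))) ->
  cdiff f z.
Proof.
  intros H.
  exists (fun w => if Ceq_dec w z then l else (f w - f z) / (w - z))%C.
  split.
  - intros w. destruct (Ceq_dec w z) as [->|n]; [ring|].
    field. now apply Cminus_neq_0.
  - destruct (Ceq_dec z z) as [_|n]; [|easy].
    intros eps He. generalize (H eps He). apply filter_imp; intros w Hw.
    destruct (Ceq_dec w z) as [->|n].
    + replace (l - l)%C with (RtoC 0) by ring. rewrite Cmod_0. lra.
    + assert (n' := Cminus_neq_0 _ _ n).
      replace ((f w - f z) / (w - z) - l)%C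
        with ((f w - f z - l * (w - z)) / (w - z))%C by now field.
      rewrite Cmod_div by easy.
      apply Rle_div_l; [now apply Cmod_gt_0|easy].
Qed.

(** The factorization in [cdiff] is demanded at every w, so the slope function of f does not serve
    for g; only its value at z is kept and passed to [cdiff_slope]. *)
Lemma cdiff_ext_loc (f g : C -> C) (z : C) :
  Cnhds z (fun w => f w = g w) -> cdiff f z -> cdiff g z.
Proof.
  intros E (p & Ep & Hp). pose proof (locally_singleton z _ E) as E0. simpl in E0.
  apply (cdiff_slope g z (p z)). intros eps He.
  generalize (filter_and _ _ E (Hp eps He)). apply filter_imp; intros w [Ew Hw].
  rewrite <- Ew, <- E0, (Ep w).
  replace (f z + p w * (w - z) - f z - p z * (w - z))%C with ((p w - p z) * (w - z))%C by ring.
  rewrite Cmod_mult. apply Rmult_le_compat_r; [apply Cmod_ge_0|easy].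
Qed.

Lemma cdiff_inv (f : C -> C) (z : C) :
  f z <> 0 -> cdiff f z -> cdiff (fun w => / f w)%C z.
Proof.
  intros Hz Hf. pose proof (cdiff_tends f z Hf) as Cf. destruct Hf as (p & Ep & Hp).
  (* [q] is the expected slope function, but only where f does not vanish; hence the detour through
     [cdiff_slope], which needs it near z only. *)
  set (q := fun w => (- p w * / (f w * f z))%C).
  assert (Hq : tends (Cnhds z) q (q z)).
  { apply tends_mult; [apply locally_filter| |].
    - now apply tends_opp; [apply locally_filter|].
    - apply tends_inv; [apply locally_filter|now apply Cmult_neq_0|].
      apply tends_mult; [apply locally_filter|easy|apply tends_const, locally_filter]. }
  apply (cdiff_slope _ z (q z)). intros eps He.
  assert (Hnz : Cnhds z (fun w => f w <> 0)).
  { assert (P : 0 < Cmod (f z) / 2).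
    { apply Cmod_gt_0 in Hz. lra. }
    generalize (Cf _ P). apply filter_imp; intros w Hw E.
    rewrite E in Hw. replace (0 - f z)%C with (- f z)%C in Hw by ring.
    rewrite Cmod_opp in Hw. lra. }
  generalize (filter_and _ _ Hnz (Hq eps He)). apply filter_imp; intros w [Ew Hw].
  replace (/ f w - / f z - q z * (w - z))%C with ((q w - q z) * (w - z))%C.
  - rewrite Cmod_mult. apply Rmult_le_compat_r; [apply Cmod_ge_0|easy].
  - enough (q w * (w - z) = / f w - / f z)%C as <- by ring.
    unfold q. replace (/ f w - / f z)%C with (- (f w - f z) / (f w * f z))%C by now field.
    rewrite (Ep w) at 2. now field.
Qed.

(** The neighbourhoods behind [ex_derive] are the discs of [C_AbsRing], those behind [cdiff] the
    squares of [C_UniformSpace]; [locally_CP] translates between them. *)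
Lemma cdiff_ex_derive (f : C -> C) (z : C) :
  cdiff f z <-> @ex_derive C_AbsRing C_NormedModule f z.
Proof.
  split.
  - intros (p & Ep & Hp). exists (p z). split.
    + apply is_linear_scal_l.
    + intros x Hx. apply (@is_filter_lim_locally_unique C_AbsRing (AbsRing_NormedModule C_AbsRing)) in Hx. subst x.
      intros [eps He]. simpl.
      destruct (proj1 (locally_CP z _) (Hp eps He)) as (d & Hd & H).
      exists (mkposreal d Hd). intros w Hw.
      change (Cmod (w - z) < d) in Hw. specialize (H w Hw).
      change (Cmod (f w - f z - (w - z) * p z) <= eps * Cmod (w - z)).
      rewrite (Ep w).
      replace (f z + p w * (w - z) - f z - (w - z) * p z)%C
        with ((p w - p z) * (w - z))%C by ring.
      rewrite Cmod_mult. apply Rmult_le_compat_r; [apply Cmod_ge_0|easy].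
  - intros (l & _ & H). specialize (H z (fun P HP => HP)).
    apply (cdiff_slope f z l). intros eps He.
    destruct (H (mkposreal eps He)) as [d Hd].
    apply locally_CP. exists d; split; [apply cond_pos|].
    intros w Hw. specialize (Hd w Hw).
    change (Cmod (f w - f z - (w - z) * l) <= eps * Cmod (w - z)) in Hd.
    now rewrite (Cmult_comm l).
Qed.

(** * Integrals and derivatives of complex functions of a real variable *)

Definition ccont_on (g : R -> C) (a b : R) : Prop :=
  forall t, a <= t <= b -> tends (locally t) g (g t).

Definition CInt (g : R -> C) (a b : R) : C :=
  (RInt (fun t => Re (g t)) a b, RInt (fun t => Im (g t)) a b).

Lemma ccont_on_sub (g : R -> C) (a b c d : R) :
  a <= c -> d <= b -> ccont_on g a b -> ccont_on g c d.
Proof. intros H1 H2 H t Ht. apply H. lra. Qed.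

Lemma ex_RInt_Re (g : R -> C) (a b : R) :
  a <= b -> ccont_on g a b -> ex_RInt (fun t => Re (g t)) a b.
Proof.
  intros Hab H. apply (@ex_RInt_continuous R_CompleteNormedModule).
  intros t. rewrite Rmin_left, Rmax_right by easy. intros Ht.
  apply (tends_Re (locally t) g), H, Ht.
Qed.

Lemma ex_RInt_Im (g : R -> C) (a b : R) :
  a <= b -> ccont_on g a b -> ex_RInt (fun t => Im (g t)) a b.
Proof.
  intros Hab H. apply (@ex_RInt_continuous R_CompleteNormedModule).
  intros t. rewrite Rmin_left, Rmax_right by easy. intros Ht.
  apply (tends_Im (locally t) g), H, Ht.
Qed.

Lemma CInt_ext (f g : R -> C) (a b : R) :
  a <= b -> (forall t, a <= t <= b -> f t = g t) -> CInt f a b = CInt g a b.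
Proof.
  intros Hab H. unfold CInt.
  f_equal; apply RInt_ext; rewrite Rmin_left, Rmax_right by easy;
    intros t Ht; rewrite H by lra; reflexivity.
Qed.

Lemma CInt_const (c : C) (a b : R) : CInt (fun _ => c) a b = (RtoC (b - a) * c)%C.
Proof.
  unfold CInt. rewrite !RInt_const. unfold scal; simpl; unfold mult; simpl.
  unfold Cmult, RtoC, Re, Im; simpl. f_equal; ring.
Qed.

Lemma CInt_minus (f g : R -> C) (a b : R) :
  a <= b -> ccont_on f a b -> ccont_on g a b ->
  CInt (fun t => f t - g t)%C a b = (CInt f a b - CInt g a b)%C.
Proof.
  intros Hab Hf Hg. unfold CInt.
  apply injective_projections.
  - apply (@RInt_minus R_CompleteNormedModule (fun t => Re (f t)) (fun t => Re (g t)));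
      now apply ex_RInt_Re.
  - apply (@RInt_minus R_CompleteNormedModule (fun t => Im (f t)) (fun t => Im (g t)));
      now apply ex_RInt_Im.
Qed.

Lemma CInt_scal (c : C) (g : R -> C) (a b : R) :
  a <= b -> ccont_on g a b -> CInt (fun t => c * g t)%C a b = (c * CInt g a b)%C.
Proof.
  intros Hab Hg. unfold CInt.
  assert (E : forall (k : R) (h : R -> R), ex_RInt h a b ->
    ex_RInt (fun t => k * h t) a b /\ RInt (fun t => k * h t) a b = k * RInt h a b).
  { intros k h Hh. split; [now apply (@ex_RInt_scal R_NormedModule)|].
    now apply (@RInt_scal R_CompleteNormedModule). }
  pose proof (ex_RInt_Re g a b Hab Hg) as HR. pose proof (ex_RInt_Im g a b Hab Hg) as HI.
  apply injective_projections; simpl.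
  - rewrite <- (proj2 (E (fst c) _ HR)), <- (proj2 (E (snd c) _ HI)).
    apply (@RInt_minus R_CompleteNormedModule (fun t => fst c * Re (g t))
             (fun t => snd c * Im (g t))); now apply E.
  - rewrite <- (proj2 (E (snd c) _ HR)), <- (proj2 (E (fst c) _ HI)).
    apply (@RInt_plus R_CompleteNormedModule (fun t => fst c * Im (g t))
             (fun t => snd c * Re (g t))); now apply E.
Qed.

Lemma CInt_Chasles (g : R -> C) (a b c : R) :
  a <= b <= c -> ccont_on g a c -> (CInt g a b + CInt g b c)%C = CInt g a c.
Proof.
  intros [Hab Hbc] H.
  assert (H1 : ccont_on g a b) by (apply (ccont_on_sub g a c); [lra|lra|easy]).
  assert (H2 : ccont_on g b c) by (apply (ccont_on_sub g a c); [lra|lra|easy]).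
  apply injective_projections.
  - apply (@RInt_Chasles R_CompleteNormedModule (fun t => Re (g t))); now apply ex_RInt_Re.
  - apply (@RInt_Chasles R_CompleteNormedModule (fun t => Im (g t))); now apply ex_RInt_Im.
Qed.

(** Estimating the two components separately costs a factor 2. This is harmless, since the later
    estimates only need some constant. *)
Lemma Cmod_CInt_le (g : R -> C) (a b M : R) :
  a <= b -> ccont_on g a b -> (forall t, a <= t <= b -> Cmod (g t) <= M) ->
  Cmod (CInt g a b) <= 2 * ((b - a) * M).
Proof.
  intros Hab Hg HM. eapply Rle_trans; [apply Cmod_le_Re_Im|]. unfold CInt; simpl.
  assert (H1 : Rabs (RInt (fun t => Re (g t)) a b) <= (b - a) * M).
  { apply abs_RInt_le_const; [easy|now apply ex_RInt_Re|].
    intros t Ht. eapply Rle_trans; [apply re_le_Cmod|now apply HM]. }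
  assert (H2 : Rabs (RInt (fun t => Im (g t)) a b) <= (b - a) * M).
  { apply abs_RInt_le_const; [easy|now apply ex_RInt_Im|].
    intros t Ht. eapply Rle_trans; [apply im_le_Cmod|now apply HM]. }
  lra.
Qed.

Definition rderiv (g : R -> C) (t : R) (l : C) : Prop :=
  is_derive (fun s => Re (g s)) t (Re l) /\ is_derive (fun s => Im (g s)) t (Im l).

Lemma rderiv_tends (g : R -> C) (t : R) (l : C) :
  rderiv g t l -> tends (locally t) g (g t).
Proof.
  intros [H1 H2]. apply (tends_ext_loc _ (fun s => (Re (g s), Im (g s)))).
  - apply filter_forall. intros s. now destruct (g s).
  - replace (g t) with (Re (g t), Im (g t)) by now destruct (g t).
    apply tends_pair; [apply locally_filter| |].
    + apply (ex_derive_continuous (fun s => Re (g s))). now exists (Re l).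
    + apply (ex_derive_continuous (fun s => Im (g s))). now exists (Im l).
Qed.

Lemma CInt_deriv (G g : R -> C) (a b : R) :
  a <= b -> (forall t, a <= t <= b -> rderiv G t (g t)) -> ccont_on g a b ->
  CInt g a b = (G b - G a)%C.
Proof.
  intros Hab HG Hg. unfold CInt.
  apply injective_projections; simpl; apply is_RInt_unique.
  - apply (is_RInt_derive (fun s => Re (G s)) (fun s => Re (g s)));
      rewrite Rmin_left, Rmax_right by easy; intros t Ht.
    + apply (proj1 (HG t Ht)).
    + apply (tends_Re (locally t) g), Hg, Ht.
  - apply (is_RInt_derive (fun s => Im (G s)) (fun s => Im (g s)));
      rewrite Rmin_left, Rmax_right by easy; intros t Ht.
    + apply (proj2 (HG t Ht)).
    + apply (tends_Im (locally t) g), Hg, Ht.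
Qed.

Lemma rderiv_eq (g : R -> C) (t : R) (l m : C) : rderiv g t l -> l = m -> rderiv g t m.
Proof. now intros H <-. Qed.

Lemma rderiv_const (c : C) (t : R) : rderiv (fun _ => c) t 0.
Proof.
  split; [exact (@is_derive_const R_AbsRing R_NormedModule (Re c) t)|
          exact (@is_derive_const R_AbsRing R_NormedModule (Im c) t)].
Qed.

Lemma rderiv_RtoC (t : R) : rderiv (fun s => RtoC s) t 1.
Proof.
  split; [exact (@is_derive_id R_AbsRing t)|
          exact (@is_derive_const R_AbsRing R_NormedModule 0 t)].
Qed.

Lemma rderiv_plus (f g : R -> C) (t : R) (l m : C) :
  rderiv f t l -> rderiv g t m -> rderiv (fun s => f s + g s)%C t (l + m).
Proof.
  intros [H1 H2] [H3 H4]; split;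
    [exact (@is_derive_plus R_AbsRing R_NormedModule _ _ _ _ _ H1 H3)|
     exact (@is_derive_plus R_AbsRing R_NormedModule _ _ _ _ _ H2 H4)].
Qed.

Lemma rderiv_mult (f g : R -> C) (t : R) (l m : C) :
  rderiv f t l -> rderiv g t m -> rderiv (fun s => f s * g s)%C t (l * g t + f t * m).
Proof.
  intros [H1 H2] [H3 H4].
  assert (E : forall u v u' v', is_derive u t u' -> is_derive v t v' ->
     is_derive (fun s : R => u s * v s) t (u' * v t + u t * v')).
  { intros u v u' v' Hu Hv. apply (is_derive_mult u v t u' v' Hu Hv). intros; apply Rmult_comm. }
  split.
  - replace (Re (l * g t + f t * m))
      with ((Re l * Re (g t) + Re (f t) * Re m) - (Im l * Im (g t) + Im (f t) * Im m))
      by (simpl; unfold Re, Im; ring).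
    exact (@is_derive_minus R_AbsRing R_NormedModule (fun s => Re (f s) * Re (g s))
             (fun s => Im (f s) * Im (g s)) t _ _ (E _ _ _ _ H1 H3) (E _ _ _ _ H2 H4)).
  - replace (Im (l * g t + f t * m))
      with ((Re l * Im (g t) + Re (f t) * Im m) + (Im l * Re (g t) + Im (f t) * Re m))
      by (simpl; unfold Re, Im; ring).
    exact (@is_derive_plus R_AbsRing R_NormedModule (fun s => Re (f s) * Im (g s))
             (fun s => Im (f s) * Re (g s)) t _ _ (E _ _ _ _ H1 H4) (E _ _ _ _ H2 H3)).
Qed.

(** * Bisection of rectangles *)

Lemma nested_intervals (u v : nat -> R) :
  (forall n, u n <= u (S n)) -> (forall n, v (S n) <= v n) -> (forall n, u n <= v n) ->
  exists x, forall n, u n <= x <= v n.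
Proof.
  intros Hu Hv Huv.
  assert (Mu : forall n k, u n <= u (n + k)%nat).
  { intros n k; induction k as [|k IH]; [rewrite Nat.add_0_r; lra|].
    rewrite Nat.add_succ_r. specialize (Hu (n + k)%nat). lra. }
  assert (Mv : forall n k, v (n + k)%nat <= v n).
  { intros n k; induction k as [|k IH]; [rewrite Nat.add_0_r; lra|].
    rewrite Nat.add_succ_r. specialize (Hv (n + k)%nat). lra. }
  assert (H : forall n k, u n <= v k).
  { intros n k. specialize (Mu n k). specialize (Mv k n). specialize (Huv (n + k)%nat).
    rewrite (Nat.add_comm k n) in Mv. lra. }
  destruct (completeness (fun x => exists n, x = u n)) as [x [Hx1 Hx2]].
  - exists (v O). intros x [n ->]. apply H.
  - now exists (u O), O.
  - exists x. intros n. split; [apply Hx1; now exists n|].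
    apply Hx2. intros y [k ->]. apply H.
Qed.

(** Goursat's argument with the integral abstracted to m. If the full rectangle had m = c > 0,
    repeated quartering would give nested rectangles with m >= c / 4^n. Their squared side sums also
    decay like 4^-n, so the local bound at the common point fails for small eps. *)
Lemma bisection (m : R -> R -> R -> R -> R) (X1 X2 Y1 Y2 : R) :
  X1 <= X2 -> Y1 <= Y2 ->
  (forall x1 xm x2 y1 ym y2, X1 <= x1 <= xm -> xm <= x2 <= X2 ->
     Y1 <= y1 <= ym -> ym <= y2 <= Y2 ->
     m x1 x2 y1 y2 <= m x1 xm y1 ym + m xm x2 y1 ym + m x1 xm ym y2 + m xm x2 ym y2) ->
  (forall x y eps, X1 <= x <= X2 -> Y1 <= y <= Y2 -> 0 < eps ->
     exists d, 0 < d /\ forall x1 x2 y1 y2, X1 <= x1 <= x -> x <= x2 <= X2 ->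
       Y1 <= y1 <= y -> y <= y2 <= Y2 -> x2 - x1 < d -> y2 - y1 < d ->
       m x1 x2 y1 y2 <= eps * ((x2 - x1) + (y2 - y1)) ^ 2) ->
  m X1 X2 Y1 Y2 <= 0.
Proof.
  intros HX HY Hsub Hloc. apply Rnot_lt_le. intros Hpos.
  set (c := m X1 X2 Y1 Y2) in *.
  set (W := X2 - X1). set (H := Y2 - Y1).
  assert (HW : 0 <= W) by (unfold W; lra). assert (HH : 0 <= H) by (unfold H; lra).
  set (h := fun n : nat => (/ 2) ^ n).
  assert (h0 : forall n, 0 < h n) by (intros n; apply pow_lt; lra).
  assert (hS : forall n, h n = 2 * h (S n)) by (intros n; unfold h; simpl; field).
  (* A rectangle of stage n is recorded by its lower left corner p alone, since its sides are W * h
     n and H * h n. *)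
  set (P := fun n (p : R * R) =>
    X1 <= fst p /\ fst p + W * h n <= X2 /\ Y1 <= snd p /\ snd p + H * h n <= Y2 /\
    c * (h n * h n) <= m (fst p) (fst p + W * h n) (snd p) (snd p + H * h n)).
  (* The premise [P n p] stands under the existential so that choice gives a successor to every
     pair; [(0, 0)] is the default where [P] fails. *)
  assert (step : forall n p, exists q, P n p -> P (S n) q /\
     fst p <= fst q /\ fst q + W * h (S n) <= fst p + W * h n /\
     snd p <= snd q /\ snd q + H * h (S n) <= snd p + H * h n).
  { intros n [x y].
    destruct (classic (P n (x, y))) as [HP|]; [|now exists (0, 0)].
    destruct HP as (P1 & P2 & P3 & P4 & P5); simpl in P1, P2, P3, P4, P5.
    rewrite (hS n) in P2, P4, P5.
    assert (a0 : 0 <= W * h (S n)) by (apply Rmult_le_pos; [easy|left; apply h0]).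
    assert (b0 : 0 <= H * h (S n)) by (apply Rmult_le_pos; [easy|left; apply h0]).
    pose proof (Hsub x (x + W * h (S n)) (x + W * (2 * h (S n)))
       y (y + H * h (S n)) (y + H * (2 * h (S n)))
       ltac:(lra) ltac:(lra) ltac:(lra) ltac:(lra)) as S4.
    set (x' := x + W * h (S n)) in *. set (y' := y + H * h (S n)) in *.
    set (x2 := x + W * (2 * h (S n))) in *. set (y2 := y + H * (2 * h (S n))) in *.
    assert (Ex : x2 = x' + W * h (S n)) by (unfold x2, x'; ring).
    assert (Ey : y2 = y' + H * h (S n)) by (unfold y2, y'; ring).
    set (k := c * (h (S n) * h (S n))).
    replace (c * (2 * h (S n) * (2 * h (S n)))) with (4 * k) in P5 by (unfold k; ring).
    rewrite Ex, Ey in *.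
    (* The four quarters have total at least 4 * k, so one of them has m >= k; each branch takes the
       corner of such a quarter. *)
    destruct (Rle_lt_dec k (m x x' y y')) as [K1|K1].
    { exists (x, y). intros _. unfold P; simpl. rewrite (hS n).
      fold x' y' k. unfold x', y' in *. repeat split; lra. }
    destruct (Rle_lt_dec k (m x' (x' + W * h (S n)) y y')) as [K2|K2].
    { exists (x', y). intros _. unfold P; simpl. rewrite (hS n).
      fold y' k. unfold x', y' in *. repeat split; lra. }
    destruct (Rle_lt_dec k (m x x' y' (y' + H * h (S n)))) as [K3|K3].
    { exists (x, y'). intros _. unfold P; simpl. rewrite (hS n).
      fold x' k. unfold x', y' in *. repeat split; lra. }
    exists (x', y'). intros _. unfold P; simpl. rewrite (hS n).
    fold k. unfold x', y' in *. repeat split; lra. }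
  pose proof (fun n p => constructive_indefinite_description _ (step n p)) as st.
  set (s := fix s n := match n with O => (X1, Y1) | S k => proj1_sig (st k (s k)) end).
  assert (Ps : forall n, P n (s n)).
  { induction n as [|n IH].
    - unfold P, h; simpl. unfold W, H.
      replace (X1 + (X2 - X1) * 1) with X2 by ring.
      replace (Y1 + (Y2 - Y1) * 1) with Y2 by ring. fold c. lra.
    - simpl. destruct (st n (s n)) as [q Hq]; simpl. now apply Hq. }
  assert (Ms : forall n,
     fst (s n) <= fst (s (S n)) /\ fst (s (S n)) + W * h (S n) <= fst (s n) + W * h n /\
     snd (s n) <= snd (s (S n)) /\ snd (s (S n)) + H * h (S n) <= snd (s n) + H * h n).
  { intros n. simpl. destruct (st n (s n)) as [q Hq]; simpl. now apply Hq. }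
  destruct (nested_intervals (fun n => fst (s n)) (fun n => fst (s n) + W * h n)) as [x Hx];
    [apply Ms|apply Ms| |].
  { intros n. specialize (Rmult_le_pos _ _ HW (Rlt_le _ _ (h0 n))). lra. }
  destruct (nested_intervals (fun n => snd (s n)) (fun n => snd (s n) + H * h n)) as [y Hy];
    [apply Ms|apply Ms| |].
  { intros n. specialize (Rmult_le_pos _ _ HH (Rlt_le _ _ (h0 n))). lra. }
  (* With this eps the local bound is at most half of c * (h N * h N), the lower bound kept in [P].
     The + 1 covers a rectangle reduced to a point. *)
  assert (Heps : 0 < c / (2 * (W + H + 1) ^ 2)).
  { apply Rdiv_lt_0_compat; [easy|]. apply Rmult_lt_0_compat; [lra|]. apply pow_lt; lra. }
  destruct (Hloc x y _
    ltac:(destruct (Ps O) as (? & ? & _); specialize (Hx O); lra)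
    ltac:(destruct (Ps O) as (_ & _ & ? & ? & _); specialize (Hy O); lra) Heps)
    as (d & Hd & HL).
  destruct (pow_lt_1_zero (/ 2) ltac:(rewrite Rabs_pos_eq; lra) (d / (W + H + 1))) as [N HN].
  { apply Rdiv_lt_0_compat; lra. }
  specialize (HN N (Nat.le_refl N)). fold (h N) in HN.
  rewrite Rabs_pos_eq in HN by (left; apply h0).
  apply Rlt_div_r in HN; [|lra].
  destruct (Ps N) as (P1 & P2 & P3 & P4 & P5). specialize (Hx N); specialize (Hy N).
  pose proof (h0 N) as h0N. simpl in Hx, Hy.
  assert (b : m (fst (s N)) (fst (s N) + W * h N) (snd (s N)) (snd (s N) + H * h N)
     <= c / (2 * (W + H + 1) ^ 2) * (W * h N + H * h N) ^ 2).
  { replace (W * h N + H * h N) with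
      ((fst (s N) + W * h N - fst (s N)) + (snd (s N) + H * h N - snd (s N))) by ring.
    apply HL; try lra; nra. }
  assert (b' : (W * h N + H * h N) ^ 2 <= (W + H + 1) ^ 2 * (h N * h N)).
  { replace ((W * h N + H * h N) ^ 2) with ((W + H) ^ 2 * (h N * h N)) by ring.
    apply Rmult_le_compat_r; [nra|]. apply pow_incr; lra. }
  assert (b'' : c / (2 * (W + H + 1) ^ 2) * (W * h N + H * h N) ^ 2 <= c / 2 * (h N * h N)).
  { replace (c / 2 * (h N * h N))
      with (c / (2 * (W + H + 1) ^ 2) * ((W + H + 1) ^ 2 * (h N * h N))) by (field; lra).
    apply Rmult_le_compat_l; lra. }
  assert (0 < c * (h N * h N)) by (repeat apply Rmult_lt_0_compat; lra).
  lra.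
Qed.

(** * Goursat's theorem on a parametrized rectangle *)

(** p and q are the partial derivatives of phi. They are required on the whole plane, which avoids
    one-sided derivatives on the edges, whereas the bounds are asked on the rectangle only. Each is
    continuous in its own variable, as integration along the sides requires. *)
Record patch (phi p q : R -> R -> C) (X1 X2 Y1 Y2 K : R) : Prop := {
  patch_X : X1 <= X2;
  patch_Y : Y1 <= Y2;
  patch_dx : forall x y, rderiv (fun x => phi x y) x (p x y);
  patch_dy : forall x y, rderiv (fun y => phi x y) y (q x y);
  patch_cx : forall x y, tends (locally x) (fun x => p x y) (p x y);
  patch_cy : forall x y, tends (locally y) (fun y => q x y) (q x y);
  patch_K : 0 < K;
  patch_bx : forall x y, X1 <= x <= X2 -> Y1 <= y <= Y2 -> Cmod (p x y) <= K;
  patch_by : forall x y, X1 <= x <= X2 -> Y1 <= y <= Y2 -> Cmod (q x y) <= K;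
  patch_lip : forall x y x' y', X1 <= x <= X2 -> Y1 <= y <= Y2 ->
    X1 <= x' <= X2 -> Y1 <= y' <= Y2 ->
    Cmod (phi x y - phi x' y') <= K * (Rabs (x - x') + Rabs (y - y'))
}.

Definition hside (F : C -> C) (phi p : R -> R -> C) (y x1 x2 : R) : C :=
  CInt (fun x => F (phi x y) * p x y)%C x1 x2.

Definition vside (F : C -> C) (phi q : R -> R -> C) (x y1 y2 : R) : C :=
  CInt (fun y => F (phi x y) * q x y)%C y1 y2.

(** This is the integral of F(w) dw over the image under phi of the positively oriented boundary. *)
Definition bdry (F : C -> C) (phi p q : R -> R -> C) (x1 x2 y1 y2 : R) : C :=
  (hside F phi p y1 x1 x2 + vside F phi q x2 y1 y2
   - hside F phi p y2 x1 x2 - vside F phi q x1 y1 y2)%C.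

Section Goursat.
Context (phi p q : R -> R -> C) (X1 X2 Y1 Y2 K : R) (HP : patch phi p q X1 X2 Y1 Y2 K).

Definition cont_along (F : C -> C) : Prop :=
  forall x y, X1 <= x <= X2 -> Y1 <= y <= Y2 -> tends (Cnhds (phi x y)) F (F (phi x y)).

Lemma hside_cont (F : C -> C) (y x1 x2 : R) :
  cont_along F -> X1 <= x1 -> x2 <= X2 -> Y1 <= y <= Y2 ->
  ccont_on (fun x => F (phi x y) * p x y)%C x1 x2.
Proof.
  intros HF H1 H2 Hy x Hx. apply tends_mult; [apply locally_filter| |apply HP].
  apply (tends_comp _ F (fun x => phi x y) (phi x y)); [apply HF; lra|].
  apply (rderiv_tends (fun x => phi x y) x (p x y)), HP.
Qed.

Lemma vside_cont (F : C -> C) (x y1 y2 : R) :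
  cont_along F -> Y1 <= y1 -> y2 <= Y2 -> X1 <= x <= X2 ->
  ccont_on (fun y => F (phi x y) * q x y)%C y1 y2.
Proof.
  intros HF H1 H2 Hx y Hy. apply tends_mult; [apply locally_filter| |apply HP].
  apply (tends_comp _ F (fun y => phi x y) (phi x y)); [apply HF; lra|].
  apply (rderiv_tends (fun y => phi x y) y (q x y)), HP.
Qed.

(** Each inner side is traversed twice, in opposite directions. *)
Lemma bdry_split (F : C -> C) (x1 xm x2 y1 ym y2 : R) :
  cont_along F -> X1 <= x1 <= xm -> xm <= x2 <= X2 -> Y1 <= y1 <= ym -> ym <= y2 <= Y2 ->
  bdry F phi p q x1 x2 y1 y2 =
  (bdry F phi p q x1 xm y1 ym + bdry F phi p q xm x2 y1 ym
   + bdry F phi p q x1 xm ym y2 + bdry F phi p q xm x2 ym y2)%C.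
Proof.
  intros HF H1 H2 H3 H4. unfold bdry.
  assert (Eh : forall y, Y1 <= y <= Y2 ->
     hside F phi p y x1 x2 = (hside F phi p y x1 xm + hside F phi p y xm x2)%C).
  { intros y Hy. symmetry. apply CInt_Chasles; [lra|]. apply hside_cont; (easy || lra). }
  assert (Ev : forall x, X1 <= x <= X2 ->
     vside F phi q x y1 y2 = (vside F phi q x y1 ym + vside F phi q x ym y2)%C).
  { intros x Hx. symmetry. apply CInt_Chasles; [lra|]. apply vside_cont; (easy || lra). }
  rewrite (Eh y1), (Eh y2), (Ev x1), (Ev x2) by lra. ring.
Qed.

Lemma bdry_minus (F G : C -> C) (x1 x2 y1 y2 : R) :
  cont_along F -> cont_along G -> X1 <= x1 <= x2 -> x2 <= X2 -> Y1 <= y1 <= y2 -> y2 <= Y2 ->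
  bdry (fun w => F w - G w)%C phi p q x1 x2 y1 y2 =
  (bdry F phi p q x1 x2 y1 y2 - bdry G phi p q x1 x2 y1 y2)%C.
Proof.
  intros HF HG H1 H2 H3 H4. unfold bdry.
  assert (Eh : forall y, Y1 <= y <= Y2 -> hside (fun w => F w - G w)%C phi p y x1 x2
     = (hside F phi p y x1 x2 - hside G phi p y x1 x2)%C).
  { intros y Hy. unfold hside. rewrite <- CInt_minus; try (apply hside_cont; (easy || lra)); [|lra].
    apply CInt_ext; [lra|]. intros; ring. }
  assert (Ev : forall x, X1 <= x <= X2 -> vside (fun w => F w - G w)%C phi q x y1 y2
     = (vside F phi q x y1 y2 - vside G phi q x y1 y2)%C).
  { intros x Hx. unfold vside. rewrite <- CInt_minus; try (apply vside_cont; (easy || lra)); [|lra].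
    apply CInt_ext; [lra|]. intros; ring. }
  rewrite !Eh, !Ev by lra. ring.
Qed.

Lemma cont_along_cdiff (F : C -> C) :
  (forall x y, X1 <= x <= X2 -> Y1 <= y <= Y2 -> cdiff F (phi x y)) -> cont_along F.
Proof. intros H x y Hx Hy. now apply cdiff_tends, H. Qed.

Lemma cdiff_affine (a l z w : C) : cdiff (fun w => a + l * (w - z))%C w.
Proof.
  apply cdiff_plus; [apply cdiff_const|]. apply cdiff_mult; [apply cdiff_const|].
  apply cdiff_minus; [apply cdiff_id|apply cdiff_const].
Qed.

(** The affine function has the primitive [P], so every side contributes a difference of two corner
    values and the four differences cancel. *)
Lemma bdry_affine (a l z : C) (x1 x2 y1 y2 : R) :
  X1 <= x1 <= x2 -> x2 <= X2 -> Y1 <= y1 <= y2 -> y2 <= Y2 ->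
  bdry (fun w => a + l * (w - z))%C phi p q x1 x2 y1 y2 = 0.
Proof.
  intros H1 H2 H3 H4.
  set (F := (fun w => a + l * (w - z))%C).
  set (P := (fun w => a * w + (l * / 2) * ((w - z) * (w - z)))%C).
  assert (HF : cont_along F) by (apply cont_along_cdiff; intros; apply cdiff_affine).
  assert (DP : forall (g : R -> C) t m, rderiv g t m -> rderiv (fun s => P (g s)) t (F (g t) * m)).
  { intros g t m Hg. unfold P, F.
    assert (Hz : rderiv (fun s => g s - z)%C t m).
    { eapply rderiv_eq; [apply (rderiv_plus g (fun _ => (- z)%C) t m 0 Hg), rderiv_const|ring]. }
    eapply rderiv_eq.
    - apply (rderiv_plus (fun s => a * g s)%C
        (fun s => (l * / 2) * ((g s - z) * (g s - z)))%C t).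
      + apply (rderiv_mult (fun _ => a) g); [apply rderiv_const|exact Hg].
      + apply (rderiv_mult (fun _ => (l * / 2)%C) (fun s => (g s - z) * (g s - z))%C);
          [apply rderiv_const|].
        exact (rderiv_mult _ _ _ _ _ Hz Hz).
    - simpl. field. }
  assert (Eh : forall y, Y1 <= y <= Y2 ->
    hside F phi p y x1 x2 = (P (phi x2 y) - P (phi x1 y))%C).
  { intros y Hy. apply (CInt_deriv (fun x => P (phi x y))); [lra| |].
    - intros x _. apply (DP (fun x => phi x y)), HP.
    - apply hside_cont; (easy || lra). }
  assert (Ev : forall x, X1 <= x <= X2 ->
    vside F phi q x y1 y2 = (P (phi x y2) - P (phi x y1))%C).
  { intros x Hx. apply (CInt_deriv (fun y => P (phi x y))); [lra| |].
    - intros y _. apply (DP (fun y => phi x y)), HP.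
    - apply vside_cont; (easy || lra). }
  unfold bdry. rewrite !Eh, !Ev by lra. ring.
Qed.

Lemma bdry_le (F : C -> C) (x1 x2 y1 y2 M : R) :
  cont_along F -> X1 <= x1 <= x2 -> x2 <= X2 -> Y1 <= y1 <= y2 -> y2 <= Y2 ->
  (forall x y, x1 <= x <= x2 -> y1 <= y <= y2 -> Cmod (F (phi x y)) <= M) ->
  Cmod (bdry F phi p q x1 x2 y1 y2) <= 4 * K * M * ((x2 - x1) + (y2 - y1)).
Proof.
  intros HF H1 H2 H3 H4 HM.
  assert (Bh : forall y, y1 <= y <= y2 -> Cmod (hside F phi p y x1 x2) <= 2 * ((x2 - x1) * (M * K))).
  { intros y Hy. apply Cmod_CInt_le; [lra|apply hside_cont; (easy || lra)|].
    intros x Hx. rewrite Cmod_mult.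
    apply Rmult_le_compat; try apply Cmod_ge_0; [now apply HM|apply HP; lra]. }
  assert (Bv : forall x, x1 <= x <= x2 -> Cmod (vside F phi q x y1 y2) <= 2 * ((y2 - y1) * (M * K))).
  { intros x Hx. apply Cmod_CInt_le; [lra|apply vside_cont; (easy || lra)|].
    intros y Hy. rewrite Cmod_mult.
    apply Rmult_le_compat; try apply Cmod_ge_0; [now apply HM|apply HP; lra]. }
  unfold bdry.
  eapply Rle_trans; [apply Cmod_triangle_minus|].
  eapply Rle_trans; [apply Rplus_le_compat_r, Cmod_triangle_minus|].
  eapply Rle_trans; [apply Rplus_le_compat_r, Rplus_le_compat_r, Cmod_triangle|].
  pose proof (Bh y1 ltac:(lra)). pose proof (Bh y2 ltac:(lra)).
  pose proof (Bv x1 ltac:(lra)). pose proof (Bv x2 ltac:(lra)). lra.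
Qed.

(** Subtracting the first-order part of F at z leaves the boundary integral unchanged. What remains
    is a small multiple of the distance to z; distance and length are both of the order of the side
    sum, hence the square in [bisection]. *)
Lemma goursat (F : C -> C) :
  (forall x y, X1 <= x <= X2 -> Y1 <= y <= Y2 -> cdiff F (phi x y)) ->
  bdry F phi p q X1 X2 Y1 Y2 = 0.
Proof.
  intros HF. pose proof (cont_along_cdiff F HF) as CF.
  apply Cmod_eq_0, Rle_antisym; [|apply Cmod_ge_0].
  apply (bisection (fun x1 x2 y1 y2 => Cmod (bdry F phi p q x1 x2 y1 y2))); try apply HP.
  - intros x1 xm x2 y1 ym y2 H1 H2 H3 H4.
    rewrite (bdry_split F x1 xm x2 y1 ym y2) by easy.
    eapply Rle_trans; [apply Cmod_triangle|]. apply Rplus_le_compat_r.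
    eapply Rle_trans; [apply Cmod_triangle|]. apply Rplus_le_compat_r. apply Cmod_triangle.
  - intros x y eps Hx Hy He. destruct (HF x y Hx Hy) as (psi & E & Hpsi).
    pose proof (patch_K _ _ _ _ _ _ _ _ HP) as HK.
    (* One factor K comes from the Lipschitz bound on the distance to z, the factor 4 * K from
       [bdry_le]. *)
    assert (He' : 0 < eps / (4 * K * K)).
    { apply Rdiv_lt_0_compat; [easy|]. repeat apply Rmult_lt_0_compat; lra. }
    specialize (Hpsi _ He'). apply locally_CP in Hpsi as (d & Hd & Hpsi).
    (* Two sides shorter than d / (2 * K) give a side sum below d / K, so the image stays within
       distance d of z. *)
    exists (d / (2 * K)). split; [apply Rdiv_lt_0_compat; lra|].
    intros x1 x2 y1 y2 H1 H2 H3 H4 H5 H6.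
    set (z := phi x y) in *.
    set (L := (fun w => F z + psi z * (w - z))%C).
    assert (CL : cont_along L) by (apply cont_along_cdiff; intros; apply cdiff_affine).
    assert (EL : bdry L phi p q x1 x2 y1 y2 = 0) by (apply bdry_affine; lra).
    replace (bdry F phi p q x1 x2 y1 y2)
      with (bdry (fun w => F w - L w)%C phi p q x1 x2 y1 y2)
      by (rewrite bdry_minus by (easy || lra); rewrite EL; ring).
    set (sz := (x2 - x1) + (y2 - y1)).
    replace (eps * sz ^ 2) with (4 * K * (eps / (4 * K * K) * (K * sz)) * sz) by (field; lra).
    apply bdry_le; try lra.
    + intros u v Hu Hv. apply tends_minus; [apply locally_filter|now apply CF|now apply CL].
    + intros u v Hu Hv. unfold L. rewrite (E (phi u v)).
      replace (F z + psi (phi u v) * (phi u v - z) - (F z + psi z * (phi u v - z)))%C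
        with ((psi (phi u v) - psi z) * (phi u v - z))%C by ring.
      rewrite Cmod_mult.
      assert (B : Cmod (phi u v - z) <= K * sz).
      { eapply Rle_trans; [apply HP; lra|]. apply Rmult_le_compat_l; [lra|].
        unfold sz. apply Rplus_le_compat; apply Rabs_le; lra. }
      apply Rmult_le_compat; try apply Cmod_ge_0; [|easy].
      apply Hpsi. eapply Rle_lt_trans; [exact B|].
      apply Rlt_div_r in H5; [|lra]. apply Rlt_div_r in H6; [|lra]. unfold sz. lra.
Qed.

End Goursat.

(** * Circles and homotopies between them *)

Definition cis (t : R) : C := (cos t, sin t).

Lemma Cmod_cis (t : R) : Cmod (cis t) = 1.
Proof.
  unfold Cmod, cis; simpl. transitivity (sqrt 1); [f_equal|apply sqrt_1].
  pose proof (sin2_cos2 t) as E. unfold Rsqr in E. lra.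
Qed.

Lemma cis_neq_0 (t : R) : cis t <> 0.
Proof. apply Cmod_gt_0. rewrite Cmod_cis. lra. Qed.

Lemma rderiv_cis (t : R) : rderiv cis t (Ci * cis t).
Proof.
  split; unfold cis; simpl; [replace (0 * cos t - 1 * sin t) with (- sin t) by ring|
                             replace (0 * sin t + 1 * cos t) with (cos t) by ring];
    [apply is_derive_cos|apply is_derive_sin].
Qed.

Lemma tends_cis (t : R) : tends (locally t) cis (cis t).
Proof. apply (rderiv_tends cis t _ (rderiv_cis t)). Qed.

Lemma cis_lip (s t : R) : Cmod (cis s - cis t) <= 2 * Rabs (s - t).
Proof.
  assert (H : forall s t, s <= t -> Cmod (cis t - cis s) <= 2 * (t - s)).
  { clear s t. intros s t Hst.
    assert (Hc : ccont_on (fun t => Ci * cis t)%C s t).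
    { intros u _. apply tends_mult; [apply locally_filter| |apply tends_cis].
      apply tends_const, locally_filter. }
    rewrite <- (CInt_deriv cis (fun t => Ci * cis t)%C s t Hst); [|intros; apply rderiv_cis|easy].
    replace (2 * (t - s)) with (2 * ((t - s) * 1)) by ring.
    apply Cmod_CInt_le; [easy|easy|].
    intros u _. rewrite Cmod_mult, Cmod_Ci, Cmod_cis. lra. }
  destruct (Rle_lt_dec s t) as [L|L].
  - rewrite Cmod_minus_sym, Rabs_minus_sym, (Rabs_pos_eq (t - s)) by lra. now apply H.
  - rewrite Rabs_pos_eq by lra. apply H. lra.
Qed.

(* The affine homotopy between two circles; it covers both shrinking a circle to
   an interior point and moving the centre of a circle. *)
Definition hom (a b c d : C) (l t : R) : C := ((a + b * cis t) + l * (c + d * cis t))%C.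
Definition hom_l (c d : C) (l t : R) : C := (c + d * cis t)%C.
Definition hom_t (b d : C) (l t : R) : C := ((b + l * d) * (Ci * cis t))%C.

(** The factor 2 is the Lipschitz constant of [cis_lip]; the + 1 keeps the constant positive when b,
    c and d vanish. The parameter starts at a free [l0] because [cauchy_slope] has to stop before
    its circle shrinks to a point. *)
Lemma hom_patch (a b c d : C) (l0 : R) : 0 <= l0 <= 1 ->
  patch (hom a b c d) (hom_l c d) (hom_t b d) l0 1 0 (2 * PI)
    (2 * (Cmod b + Cmod c + Cmod d) + 1).
Proof.
  intros Hl0.
  pose proof (Cmod_ge_0 b) as Hb. pose proof (Cmod_ge_0 c) as Hc. pose proof (Cmod_ge_0 d) as Hd.
  assert (Bl : forall l t, Cmod (hom_l c d l t) <= Cmod c + Cmod d).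
  { intros l t. unfold hom_l. eapply Rle_trans; [apply Cmod_triangle|].
    rewrite Cmod_mult, Cmod_cis. lra. }
  assert (Bb : forall l : R, l0 <= l <= 1 -> Cmod (b + l * d) <= Cmod b + Cmod d).
  { intros l Hl. eapply Rle_trans; [apply Cmod_triangle|].
    rewrite Cmod_mult, Cmod_R, Rabs_pos_eq by lra. nra. }
  split; try easy; try lra.
  - pose proof PI_RGT_0. lra.
  - intros l t. unfold hom, hom_l. eapply rderiv_eq.
    + apply (rderiv_plus (fun _ => (a + b * cis t)%C) (fun l : R => l * (c + d * cis t))%C);
        [apply rderiv_const|].
      apply (rderiv_mult RtoC (fun _ => (c + d * cis t)%C)); [apply rderiv_RtoC|apply rderiv_const].
    + simpl. ring.
  - intros l t. unfold hom, hom_t.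
    assert (D : forall u v : C, rderiv (fun t => u + v * cis t)%C t (v * (Ci * cis t))).
    { intros u v. eapply rderiv_eq.
      - apply (rderiv_plus (fun _ => u)); [apply rderiv_const|].
        apply (rderiv_mult (fun _ => v) cis); [apply rderiv_const|apply rderiv_cis].
      - ring. }
    eapply rderiv_eq.
    + eapply rderiv_plus; [apply (D a b)|].
      apply (rderiv_mult (fun _ => RtoC l) _ _ _ _ (rderiv_const (RtoC l) t) (D c d)).
    + simpl. ring.
  - intros l t. exact (tends_const (locally l) (c + d * cis t)%C).
  - intros l t. apply tends_mult; [apply locally_filter|apply tends_const, locally_filter|].
    apply tends_mult; [apply locally_filter|apply tends_const, locally_filter|apply tends_cis].
  - intros l t _ _. eapply Rle_trans; [apply Bl|]. lra.
  - intros l t Hl _. unfold hom_t. rewrite !Cmod_mult, Cmod_Ci, Cmod_cis.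
    specialize (Bb l Hl). lra.
  - intros l t l' t' Hl _ _ _.
    replace (hom a b c d l t - hom a b c d l' t')%C
      with ((b + l * d) * (cis t - cis t') + RtoC (l - l') * hom_l c d l t')%C
      by (unfold hom, hom_l; rewrite RtoC_minus; ring).
    eapply Rle_trans; [apply Cmod_triangle|]. rewrite !Cmod_mult, Cmod_R.
    specialize (Bb l Hl). specialize (Bl l t'). pose proof (cis_lip t t') as Lt.
    pose proof (Rabs_pos (l - l')). pose proof (Rabs_pos (t - t')).
    assert (Cmod (b + l * d) * Cmod (cis t - cis t') <= (Cmod b + Cmod d) * (2 * Rabs (t - t')))
      by (apply Rmult_le_compat; try apply Cmod_ge_0; easy).
    assert (Rabs (l - l') * Cmod (hom_l c d l t') <= Rabs (l - l') * (Cmod c + Cmod d))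
      by (apply Rmult_le_compat_l; easy).
    nra.
Qed.

Lemma cis_period : cis (2 * PI) = cis 0.
Proof. unfold cis. now rewrite cos_2PI, sin_2PI, cos_0, sin_0. Qed.

(** The integral of F(w) dw over the circle with centre a + l c and complex radius b + l d. *)
Definition loop (F : C -> C) (a b c d : C) (l : R) : C :=
  CInt (fun t => F (hom a b c d l t) * hom_t b d l t)%C 0 (2 * PI).

Lemma loop_cont (F : C -> C) (a b c d : C) (l0 : R) : 0 <= l0 <= 1 ->
  (forall l t, l0 <= l <= 1 -> cdiff F (hom a b c d l t)) ->
  ccont_on (fun t => F (hom a b c d l0 t) * hom_t b d l0 t)%C 0 (2 * PI).
Proof.
  intros Hl0 HF.
  apply (vside_cont _ _ _ _ _ _ _ _ (hom_patch a b c d l0 Hl0)); try lra.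
  apply cont_along_cdiff. intros l t Hl _. now apply HF.
Qed.

(** The edges t = 0 and t = 2 * PI of the rectangle have the same image, so they cancel in [goursat]
    and the two loops remain. *)
Lemma loop_homotopy (F : C -> C) (a b c d : C) (l0 : R) : 0 <= l0 <= 1 ->
  (forall l t, l0 <= l <= 1 -> cdiff F (hom a b c d l t)) ->
  loop F a b c d 1 = loop F a b c d l0.
Proof.
  intros Hl0 HF.
  pose proof (goursat _ _ _ _ _ _ _ _ (hom_patch a b c d l0 Hl0) F
    (fun l t Hl _ => HF l t Hl)) as G.
  assert (E : hside F (hom a b c d) (hom_l c d) (2 * PI) l0 1
            = hside F (hom a b c d) (hom_l c d) 0 l0 1).
  { unfold hside, hom, hom_l. now rewrite cis_period. }
  unfold bdry in G. rewrite E in G. unfold vside in G. fold (loop F a b c d 1) in G.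
  fold (loop F a b c d l0) in G.
  match type of G with (?h + ?u - ?h - ?v)%C = _ => 
    replace u with (h + u - h - v + v)%C by ring end.
  rewrite G. ring.
Qed.

Lemma Cmod_circle (r t : R) : 0 < r -> Cmod (r * cis t) = r.
Proof. intros Hr. rewrite Cmod_mult, Cmod_R, Cmod_cis, Rabs_pos_eq; lra. Qed.

Lemma circle_minus_neq_0 (r t : R) (z : C) : 0 < r -> Cmod z < r -> (r * cis t - z)%C <> 0.
Proof.
  intros Hr Hz. apply Cmod_gt_0. eapply Rlt_le_trans; [|apply Cmod_triangle_rev].
  rewrite Cmod_circle; lra.
Qed.

(** * Cauchy's integral formula *)

(** After translation by -z the integrand is 1/w. Sliding the centre from -z to 0 never lets the
    circle meet 0, and around 0 the integrand is the constant [Ci]. *)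
Lemma winding_number (r : R) (z : C) : 0 < r -> Cmod z < r ->
  CInt (fun t => / (r * cis t - z) * (r * (Ci * cis t)))%C 0 (2 * PI) = (RtoC (2 * PI) * Ci)%C.
Proof.
  intros Hr Hz. pose proof PI_RGT_0 as Hpi.
  assert (Hrc : RtoC r <> 0) by (intros E; apply RtoC_inj in E; lra).
  transitivity (loop (fun w => / w)%C 0 r (- z) 0 1).
  { apply CInt_ext; [lra|]. intros t _. unfold hom, hom_t.
    f_equal; [f_equal|]; ring. }
  rewrite (loop_homotopy _ _ _ _ _ 0); [|lra|].
  - replace (2 * PI) with (2 * PI - 0) by ring. rewrite <- CInt_const.
    apply CInt_ext; [lra|]. intros t _. unfold hom, hom_t.
    pose proof (cis_neq_0 t). now field.
  - intros l t Hl. apply cdiff_inv; [|apply cdiff_id].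
    replace (hom 0 r (- z) 0 l t) with (r * cis t - l * z)%C by (unfold hom; ring).
    apply circle_minus_neq_0; [easy|]. rewrite Cmod_mult, Cmod_R, Rabs_pos_eq by lra.
    pose proof (Cmod_ge_0 z). nra.
Qed.

(** The homotopy is the homothety of ratio l centred at z. It avoids z for l > 0, so the integral
    does not depend on l; near z the quotient is bounded, so the integral is O(l) and must
    vanish. *)
Lemma cauchy_slope (F : C -> C) (r : R) (z : C) : 0 < r -> Cmod z < r ->
  (forall w, Cmod w <= r -> cdiff F w) ->
  loop (fun w => (F w - F z) * / (w - z))%C z 0 (- z) r 1 = 0.
Proof.
  intros Hr Hz HF. pose proof PI_RGT_0 as Hpi.
  set (q := (fun w => (F w - F z) * / (w - z))%C).
  assert (Hphi : forall (l t : R), (hom z 0 (- z) r l t - z = l * (r * cis t - z))%C)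
    by (intros; unfold hom; ring).
  assert (Hq : forall l0, 0 < l0 <= 1 -> forall l t, l0 <= l <= 1 -> cdiff q (hom z 0 (- z) r l t)).
  { intros l0 Hl0 l t Hl. unfold q. apply cdiff_mult.
    - apply cdiff_minus; [|apply cdiff_const]. apply HF.
      (* A convex combination of z and a point of the circle stays in the closed disc. *)
      replace (hom z 0 (- z) r l t) with (RtoC (1 - l) * z + l * (r * cis t))%C
        by (unfold hom; rewrite RtoC_minus; ring).
      eapply Rle_trans; [apply Cmod_triangle|].
      rewrite Cmod_mult, (Cmod_mult l), !Cmod_R, Cmod_circle by easy.
      rewrite !Rabs_pos_eq by lra. nra.
    - apply (cdiff_inv (fun w => w - z)%C); [|apply cdiff_minus; [apply cdiff_id|apply cdiff_const]].
      rewrite Hphi. apply Cmult_neq_0; [|now apply circle_minus_neq_0].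
      intros E; apply RtoC_inj in E; lra. }
  destruct (HF z ltac:(lra)) as (psi & E & Hpsi).
  specialize (Hpsi 1 ltac:(lra)). apply locally_CP in Hpsi as (d & Hd & Hpsi).
  set (B := Cmod (psi z) + 1).
  assert (HB : 0 < B) by (pose proof (Cmod_ge_0 (psi z)); unfold B; lra).
  assert (Bd : forall l, 0 < l <= 1 -> l * (2 * r) < d ->
     Cmod (loop q z 0 (- z) r 1) <= l * (4 * PI * (B * r))).
  { intros l Hl Hld. rewrite (loop_homotopy q z 0 (- z) r l) by (lra || now apply Hq).
    replace (l * (4 * PI * (B * r))) with (2 * ((2 * PI - 0) * (B * (l * r)))) by ring.
    apply Cmod_CInt_le; [lra|apply loop_cont; [lra|now apply Hq]|].
    intros t _.
    assert (Hn : (hom z 0 (- z) r l t - z)%C <> 0).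
    { rewrite Hphi. apply Cmult_neq_0; [|now apply circle_minus_neq_0].
      intros E'; apply RtoC_inj in E'; lra. }
    replace (q (hom z 0 (- z) r l t)) with (psi (hom z 0 (- z) r l t))
      by (unfold q; rewrite (E (hom z 0 (- z) r l t)); field; exact Hn).
    unfold hom_t. rewrite !Cmod_mult, Cmod_Ci, Cmod_cis.
    replace (0 + l * r)%C with (RtoC (l * r)) by (rewrite RtoC_mult; ring).
    rewrite Cmod_R, Rabs_pos_eq by nra. rewrite !Rmult_1_r.
    apply Rmult_le_compat_r; [nra|].
    assert (Hc : Cmod (psi (hom z 0 (- z) r l t) - psi z) <= 1).
    { apply Hpsi. rewrite Hphi, Cmod_mult, Cmod_R, Rabs_pos_eq by lra.
      eapply Rle_lt_trans; [|exact Hld]. apply Rmult_le_compat_l; [lra|].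
      eapply Rle_trans; [apply Cmod_triangle_minus|]. rewrite Cmod_circle by easy. lra. }
    pose proof (Cmod_triangle_rev (psi (hom z 0 (- z) r l t)) (psi z)). unfold B. lra. }
  apply Cmod_eq_0, Rle_antisym; [|apply Cmod_ge_0].
  apply le_epsilon. intros eps Heps. rewrite Rplus_0_l.
  set (S := 4 * PI * (B * r)).
  assert (HS : 0 < S) by (unfold S; pose proof (Rmult_lt_0_compat _ _ HB Hr); nra).
  (* All points of the shrunken circle are within 2 * r * l of z, and l <= d / (4 * r) makes this
     less than d; l <= eps / S makes the bound of [Bd] at most eps. *)
  set (l := Rmin 1 (Rmin (d / (4 * r)) (eps / S))).
  assert (l1 : l <= 1) by apply Rmin_l.
  assert (l2 : l <= d / (4 * r)) by (eapply Rle_trans; [apply Rmin_r|apply Rmin_l]).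
  assert (l3 : l <= eps / S) by (eapply Rle_trans; [apply Rmin_r|apply Rmin_r]).
  assert (l4 : 0 < l).
  { repeat apply Rmin_glb_lt; [lra| |]; apply Rdiv_lt_0_compat; lra. }
  apply Rle_div_r in l2; [|lra]. apply Rle_div_r in l3; [|lra].
  eapply Rle_trans; [apply (Bd l); lra|exact l3].
Qed.

Lemma circle_cont (F : C -> C) (r : R) : 0 < r ->
  (forall w, Cmod w = r -> cdiff F w) ->
  forall t, tends (locally t) (fun t => F (r * cis t)%C) (F (r * cis t)%C).
Proof.
  intros Hr HF t. apply (tends_comp _ F (fun t => r * cis t)%C (r * cis t)%C).
  - apply cdiff_tends, HF. now apply Cmod_circle.
  - apply tends_mult; [apply locally_filter| |apply tends_cis].
    apply tends_const, locally_filter.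
Qed.

(** F = (F - F z) + F z: the first part is killed by [cauchy_slope], the constant part is evaluated
    by [winding_number]. *)
Lemma cauchy_formula (F : C -> C) (r : R) (z : C) : 0 < r -> Cmod z < r ->
  (forall w, Cmod w <= r -> cdiff F w) ->
  CInt (fun t => F (r * cis t) * / (r * cis t - z) * (r * (Ci * cis t)))%C 0 (2 * PI)
  = (RtoC (2 * PI) * Ci * F z)%C.
Proof.
  intros Hr Hz HF. pose proof PI_RGT_0 as Hpi.
  assert (K : forall G, (forall w, Cmod w = r -> cdiff G w) ->
    ccont_on (fun t => G (r * cis t) * / (r * cis t - z) * (r * (Ci * cis t)))%C 0 (2 * PI)).
  { intros G HG t _.
    (* Reordered in this way, the integrand is a function of the point r * cis t alone, as
       [circle_cont] expects. *)
    apply (tends_ext_loc _ (fun t => G (r * cis t) * / (r * cis t - z) * (Ci * (r * cis t)))%C).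
    - apply filter_forall. intros; ring.
    - replace (r * (Ci * cis t))%C with (Ci * (r * cis t))%C by ring.
      apply (circle_cont (fun w => G w * / (w - z) * (Ci * w))%C r Hr).
      intros w Hw. apply cdiff_mult; [apply cdiff_mult; [now apply HG|]|].
      + apply (cdiff_inv (fun w => w - z)%C).
        * apply Cmod_gt_0. eapply Rlt_le_trans; [|apply Cmod_triangle_rev]. lra.
        * apply cdiff_minus; [apply cdiff_id|apply cdiff_const].
      + apply cdiff_mult; [apply cdiff_const|apply cdiff_id]. }
  assert (E := cauchy_slope F r z Hr Hz HF).
  assert (E2 : loop (fun w => (F w - F z) * / (w - z))%C z 0 (- z) r 1 =
    (CInt (fun t => F (r * cis t) * / (r * cis t - z) * (r * (Ci * cis t))) 0 (2 * PI)
     - F z * CInt (fun t => 1 * / (r * cis t - z) * (r * (Ci * cis t))) 0 (2 * PI))%C).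
  { rewrite <- CInt_scal, <- CInt_minus; [|lra| | |lra|].
    - apply CInt_ext; [lra|]. intros t _. unfold hom, hom_t.
      replace (z + 0 * cis t + 1 * (- z + r * cis t))%C with (r * cis t)%C by ring. ring.
    - apply K. intros w Hw. apply HF; lra.
    - intros t Ht. apply tends_mult; [apply locally_filter|apply tends_const, locally_filter|].
      apply (K (fun _ => RtoC 1)); [intros; apply cdiff_const|easy].
    - apply (K (fun _ => RtoC 1)). intros; apply cdiff_const. }
  rewrite (CInt_ext (fun t => 1 * / (r * cis t - z) * (r * (Ci * cis t)))%C
    (fun t => / (r * cis t - z) * (r * (Ci * cis t)))%C) in E2 by (lra || intros; ring).
  rewrite winding_number in E2 by easy. rewrite E in E2.
  match goal with |- ?x = _ => replace x with (x - F z * (RtoC (2 * PI) * Ci) + F z * (RtoC (2 * PI) * Ci))%C by ring end.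
  rewrite <- E2. ring.
Qed.

(** * Taylor expansion with remainder *)

Lemma tends_pow {T : Type} (F : (T -> Prop) -> Prop) {FF : Filter F} (f : T -> C) (l : C) (n : nat) :
  tends F f l -> tends F (fun x => f x ^ n)%C (l ^ n).
Proof.
  intros Hf. induction n as [|n IH]; simpl.
  - now apply tends_const.
  - now apply tends_mult.
Qed.

(** Cauchy's kernel is expanded by 1/(v - z) = 1/v + (z/v) * 1/(v - z), applied four times; the last
    integral is bounded for Cmod z <= r / 2 because there Cmod (v - z) >= r / 2. *)
Lemma taylor_order_3 (F : C -> C) (r B : R) : 0 < r ->
  (forall w, Cmod w <= r -> cdiff F w) ->
  (forall w, Cmod w <= r -> Cmod (F w) <= B) ->
  exists (c0 c1 c2 c3 : C) (K : R), 0 <= K /\ forall z, Cmod z <= r / 2 ->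
    Cmod (F z - (c0 + z * (c1 + z * (c2 + z * c3)))) <= K * Cmod z ^ 4.
Proof.
  intros Hr HF HB. pose proof PI_RGT_0 as Hpi.
  set (G := (fun t => F (r * cis t) * (r * (Ci * cis t)))%C).
  (* k counts the powers of the circle point in the denominator, so the coefficient of z^k is
     [I (S k)] divided by 2 pi i, and [Q z 0] is the full Cauchy integral. *)
  set (I := fun k => CInt (fun t => G t * / (r * cis t) ^ k)%C 0 (2 * PI)).
  set (Q := fun (z : C) k => CInt (fun t => G t * / (r * cis t) ^ k * / (r * cis t - z))%C 0 (2 * PI)).
  assert (Hrc : RtoC r <> 0) by (intros E; apply RtoC_inj in E; lra).
  assert (Hnz : forall t, (r * cis t)%C <> 0) by (intros t; apply Cmult_neq_0; [easy|apply cis_neq_0]).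
  assert (Hcirc : forall t, tends (locally t) (fun t => r * cis t)%C (r * cis t)%C).
  { intros t. apply tends_mult; [apply locally_filter| |apply tends_cis].
    apply tends_const, locally_filter. }
  assert (HG : forall k, ccont_on (fun t => G t * / (r * cis t) ^ k)%C 0 (2 * PI)).
  { intros k t _. apply tends_mult; [apply locally_filter| |].
    - apply tends_mult; [apply locally_filter| |].
      + apply (circle_cont F r Hr). intros; apply HF; lra.
      + apply tends_mult; [apply locally_filter|apply tends_const, locally_filter|].
        apply tends_mult; [apply locally_filter|apply tends_const, locally_filter|apply tends_cis].
    - apply tends_inv; [apply locally_filter|now apply Cpow_nz|].
      apply tends_pow; [apply locally_filter|apply Hcirc]. }
  assert (HQ : forall z k, Cmod z < r ->
    ccont_on (fun t => G t * / (r * cis t) ^ k * / (r * cis t - z))%C 0 (2 * PI)).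
  { intros z k Hz t Ht. apply tends_mult; [apply locally_filter|now apply HG|].
    apply tends_inv; [apply locally_filter|now apply circle_minus_neq_0|].
    apply tends_minus; [apply locally_filter|apply Hcirc|apply tends_const, locally_filter]. }
  assert (rec : forall z k, Cmod z < r -> Q z k = (I (S k) + z * Q z (S k))%C).
  { intros z k Hz. unfold Q, I.
    rewrite <- CInt_scal by (lra || now apply HQ).
    match goal with |- ?x = (?u + ?v)%C =>
      enough (E : (x - v = u)%C) by (rewrite <- E; ring) end.
    rewrite <- CInt_minus; [|lra|now apply HQ|].
    - apply CInt_ext; [lra|]. intros t _. simpl.
      pose proof (Hnz t). pose proof (Cpow_nz _ k (Hnz t)).
      pose proof (circle_minus_neq_0 r t z Hr Hz) as Hn. pose proof (cis_neq_0 t). field. repeat split; easy.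
    - intros t Ht. apply tends_mult; [apply locally_filter|apply tends_const, locally_filter|].
      now apply HQ. }
  set (u := (RtoC (2 * PI) * Ci)%C).
  assert (Hu : u <> 0).
  { apply Cmod_gt_0. unfold u. rewrite Cmod_mult, Cmod_Ci, Cmod_R, Rabs_pos_eq; lra. }
  exists (I 1%nat / u)%C, (I 2%nat / u)%C, (I 3%nat / u)%C, (I 4%nat / u)%C.
  (* The bound of [Cmod_CInt_le] for [Q z 4]: B * r for G, then r^4 and r / 2 from the two
     denominators. *)
  set (M := 2 * ((2 * PI - 0) * (B * r * / r ^ 4 * / (r / 2)))).
  assert (HB0 : 0 <= B).
  { eapply Rle_trans; [apply (Cmod_ge_0 (F 0))|apply HB]. rewrite Cmod_0; lra. }
  assert (Hr4 : 0 < r ^ 4) by now apply pow_lt.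
  assert (HM : 0 <= M).
  { unfold M. apply Rmult_le_pos; [lra|]. apply Rmult_le_pos; [lra|].
    apply Rmult_le_pos; [|left; apply Rinv_0_lt_compat; lra].
    apply Rmult_le_pos; [|left; now apply Rinv_0_lt_compat]. apply Rmult_le_pos; lra. }
  assert (Hcu : 0 < Cmod u) by now apply Cmod_gt_0.
  exists (M / Cmod u). split.
  { apply Rmult_le_pos; [easy|]. left; now apply Rinv_0_lt_compat. }
  intros z Hz. assert (Hz' : Cmod z < r) by lra.
  assert (E : (u * F z = I 1%nat + z * (I 2%nat + z * (I 3%nat + z * (I 4%nat + z * Q z 4%nat))))%C).
  { rewrite <- !rec by easy. unfold u. rewrite <- (cauchy_formula F r z Hr Hz' HF).
    apply CInt_ext; [lra|]. intros t _. unfold G. simpl. field.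
    now apply circle_minus_neq_0. }
  replace (F z - (I 1%nat / u + z * (I 2%nat / u + z * (I 3%nat / u + z * (I 4%nat / u)))))%C
    with (Q z 4%nat / u * z ^ 4)%C
    by (replace (F z) with (u * F z / u)%C by (field; exact Hu); rewrite E; field; exact Hu).
  rewrite Cmod_mult, Cmod_pow, Cmod_div by easy.
  apply Rmult_le_compat_r; [apply pow_le, Cmod_ge_0|].
  apply Rmult_le_compat_r; [left; now apply Rinv_0_lt_compat|].
  apply Cmod_CInt_le; [lra|now apply HQ|].
  intros t _. unfold G.
  rewrite !Cmod_mult, !Cmod_inv by (try apply Cpow_nz; easy || now apply circle_minus_neq_0).
  rewrite Cmod_pow, Cmod_circle, Cmod_Ci, Cmod_cis, Cmod_R, (Rabs_pos_eq r) by lra.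
  rewrite !Rmult_1_l, !Rmult_1_r.
  assert (H1 : r / 2 <= Cmod (r * cis t - z)).
  { eapply Rle_trans; [|apply Cmod_triangle_rev]. rewrite Cmod_circle by easy. lra. }
  apply Rmult_le_compat.
  - apply Rmult_le_pos; [apply Rmult_le_pos; [apply Cmod_ge_0|lra]|].
    left; now apply Rinv_0_lt_compat.
  - left; apply Rinv_0_lt_compat; lra.
  - apply Rmult_le_compat_r; [left; now apply Rinv_0_lt_compat|].
    apply Rmult_le_compat_r; [lra|]. apply HB. rewrite Cmod_circle; lra.
  - apply Rinv_le_contravar; lra.
Qed.

(** * Riemann's theorem on removable singularities *)

Lemma is_zero_of_linear_bound (x K d : R) : 0 < d ->
  (forall s, 0 < s <= d -> x <= K * s) -> x <= 0.
Proof.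
  intros Hd H. apply Rnot_lt_le. intros Hx.
  pose proof (Rabs_pos K) as HK. pose proof (Rle_abs K) as HK'.
  set (s := Rmin d (x / (2 * (Rabs K + 1)))).
  assert (s1 : s <= d) by apply Rmin_l.
  assert (s2 : s <= x / (2 * (Rabs K + 1))) by apply Rmin_r.
  assert (s3 : 0 < s) by (apply Rmin_glb_lt; [lra|apply Rdiv_lt_0_compat; lra]).
  apply Rle_div_r in s2; [|lra]. specialize (H s ltac:(lra)). nra.
Qed.

(** Boundedness makes w^2 f(w) at most Cmod w ^ 2, hence differentiable at 0 as well. Its expansion
    must start in degree two, and dividing by w^2 gives f(w) = c2 + c3 w + O(w^2), so c2 is the
    missing value and c3 the derivative there. *)
Lemma riemann_removable (f : C -> C) (rho : R) : 0 < rho ->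
  (forall w, 0 < Cmod w < rho -> cdiff f w) ->
  (forall w, 0 < Cmod w < rho -> Cmod (f w) <= 1) ->
  exists g : C -> C, (forall w, Cmod w < rho -> cdiff g w) /\ (forall w : C, w <> 0 -> g w = f w).
Proof.
  intros Hrho Hf Hb.
  set (F := (fun w => w * w * f w)%C).
  assert (F0 : F 0 = 0) by (unfold F; ring).
  assert (BF : forall w, Cmod w < rho -> Cmod (F w) <= Cmod w * Cmod w).
  { intros w Hw. destruct (Ceq_dec w 0) as [->|n]; [rewrite F0, Cmod_0; lra|].
    apply Cmod_gt_0 in n. unfold F. rewrite !Cmod_mult. specialize (Hb w ltac:(lra)).
    pose proof (Cmod_ge_0 (f w)). nra. }
  assert (DF : forall w, Cmod w < rho -> cdiff F w).
  { intros w Hw. destruct (Ceq_dec w 0) as [->|n].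
    - apply (cdiff_slope F 0 0). intros eps He. apply locally_CP.
      exists (Rmin eps rho). split; [now apply Rmin_glb_lt|].
      intros w Hw'. rewrite F0.
      replace (F w - 0 - 0 * (w - 0))%C with (F w) by ring.
      replace (w - 0)%C with w in * by ring.
      assert (H1 : Cmod w < eps) by (eapply Rlt_le_trans; [exact Hw'|apply Rmin_l]).
      assert (H2 : Cmod w < rho) by (eapply Rlt_le_trans; [exact Hw'|apply Rmin_r]).
      eapply Rle_trans; [now apply BF|]. pose proof (Cmod_ge_0 w). nra.
    - apply Cmod_gt_0 in n. apply cdiff_mult; [|apply Hf; lra].
      apply cdiff_mult; apply cdiff_id. }
  (* Radius rho / 2 keeps the closed disc inside the domain; the expansion then holds for Cmod z <=
     rho / 4. *)
  destruct (taylor_order_3 F (rho / 2) (rho * rho)) as (c0 & c1 & c2 & c3 & K & HK & HT).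
  { lra. }
  { intros w Hw. apply DF. lra. }
  { intros w Hw. eapply Rle_trans; [apply BF; lra|]. pose proof (Cmod_ge_0 w). nra. }
  assert (E0 : c0 = 0).
  { apply Cmod_eq_0, Rle_antisym; [|apply Cmod_ge_0].
    specialize (HT 0). rewrite Cmod_0, F0 in HT.
    replace (0 - (c0 + 0 * (c1 + 0 * (c2 + 0 * c3))))%C with (- c0)%C in HT by ring.
    rewrite Cmod_opp in HT. simpl in HT. lra. }
  subst c0.
  assert (E1 : c1 = 0).
  { apply Cmod_eq_0, Rle_antisym; [|apply Cmod_ge_0].
    (* At a real s in (0, 1], the summands 1, Cmod c2, Cmod c3 and K bound F s, the two higher terms
       and the remainder, each as a multiple of s^2; division by s leaves Cmod c1 = O(s). *)
    apply (is_zero_of_linear_bound _ (1 + Cmod (c2) + Cmod c3 + K) (Rmin 1 (rho / 4)));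
      [apply Rmin_glb_lt; lra|].
    intros s [Hs Hs'].
    assert (s1 : s <= 1) by (eapply Rle_trans; [exact Hs'|apply Rmin_l]).
    assert (s2 : s <= rho / 4) by (eapply Rle_trans; [exact Hs'|apply Rmin_r]).
    assert (Hms : Cmod s = s) by (rewrite Cmod_R; apply Rabs_pos_eq; lra).
    specialize (HT s). specialize (BF s). rewrite Hms in HT, BF.
    specialize (HT ltac:(lra)). specialize (BF ltac:(lra)).
    apply (Rmult_le_reg_l s); [easy|].
    assert (H : Cmod (s * c1) <= Cmod (F s - (0 + s * (c1 + s * (c2 + s * c3)))) + Cmod (F s)
         + Cmod (s * s * c2) + Cmod (s * s * s * c3)).
    { replace (s * c1)%C with (- (F s - (0 + s * (c1 + s * (c2 + s * c3)))) + F s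
         - s * s * c2 - s * s * s * c3)%C by ring.
      eapply Rle_trans; [apply Cmod_triangle_minus|]. apply Rplus_le_compat_r.
      eapply Rle_trans; [apply Cmod_triangle_minus|]. apply Rplus_le_compat_r.
      eapply Rle_trans; [apply Cmod_triangle|]. rewrite Cmod_opp. lra. }
    rewrite !Cmod_mult, Hms in H.
    eapply Rle_trans; [exact H|].
    pose proof (Cmod_ge_0 c3) as H3.
    assert (s * s * s <= s * s) by nra.
    assert (s * s * s * Cmod c3 <= s * s * Cmod c3) by (apply Rmult_le_compat_r; lra).
    assert (s ^ 4 <= s * s) by (simpl; nra).
    assert (K * s ^ 4 <= K * (s * s)) by (apply Rmult_le_compat_l; lra).
    lra. }
  subst c1.
  exists (fun w => if Ceq_dec w 0 then c2 else f w).
  split; [|intros w n; cbv beta; now destruct (Ceq_dec w 0)].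
  intros w Hw. destruct (Ceq_dec w 0) as [->|n].
  - apply (cdiff_slope _ 0 c3). intros eps He. apply locally_CP.
    (* Within this radius K * Cmod w ^ 2 <= eps * Cmod w; the + 1 covers K = 0. *)
    assert (Hek : 0 < eps / (K + 1)) by (apply Rdiv_lt_0_compat; lra).
    exists (Rmin (rho / 4) (eps / (K + 1))). split; [apply Rmin_glb_lt; lra|].
    intros w Hw'. destruct (Ceq_dec 0 0) as [_|n]; [|easy].
    replace (w - 0)%C with w in * by ring.
    destruct (Ceq_dec w 0) as [->|n].
    { replace (c2 - c2 - c3 * 0)%C with (RtoC 0) by ring. rewrite Cmod_0. lra. }
    assert (H1 : Cmod w < rho / 4) by (eapply Rlt_le_trans; [exact Hw'|apply Rmin_l]).
    assert (H2 : Cmod w < eps / (K + 1)) by (eapply Rlt_le_trans; [exact Hw'|apply Rmin_r]).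
    apply Rlt_div_r in H2; [|lra].
    assert (n' := proj1 (Cmod_gt_0 w) n).
    specialize (HT w ltac:(lra)).
    replace (F w - (0 + w * (0 + w * (c2 + w * c3))))%C
      with (w * w * (f w - c2 - c3 * w))%C in HT by (unfold F; ring).
    rewrite !Cmod_mult in HT.
    assert (HT' : Cmod (f w - c2 - c3 * w) <= K * (Cmod w * Cmod w)).
    { apply (Rmult_le_reg_l (Cmod w * Cmod w)); [nra|]. simpl in HT. lra. }
    eapply Rle_trans; [exact HT'|]. nra.
  - apply (cdiff_ext_loc f); [|apply Cmod_gt_0 in n; apply Hf; lra].
    apply locally_CP. exists (Cmod w). split; [now apply Cmod_gt_0|].
    intros v Hv. destruct (Ceq_dec v 0) as [->|_]; [|easy].
    replace (0 - w)%C with (- w)%C in Hv by ring. rewrite Cmod_opp in Hv. lra.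
Qed.

(** * Functions with values in a half-plane *)

(** At z = 0 the kernel of [cauchy_formula] reduces to the constant [Ci], so g 0 is the average of g
    over a circle that avoids 0, where the imaginary part is positive. *)
Lemma mean_value_Im_pos (g : C -> C) (rho : R) : 0 < rho ->
  (forall w, Cmod w < rho -> cdiff g w) ->
  (forall w, 0 < Cmod w < rho -> 0 < Im (g w)) -> 0 < Im (g 0).
Proof.
  intros Hrho Hg Hpos. pose proof PI_RGT_0 as Hpi.
  set (r := rho / 2). assert (Hr : 0 < r) by (unfold r; lra).
  assert (Hr' : r < rho) by (unfold r; lra).
  assert (Hc : ccont_on (fun t => g (r * cis t))%C 0 (2 * PI)).
  { intros t _. apply (circle_cont g r Hr). intros w Hw. apply Hg. lra. }
  assert (E : CInt (fun t => g (r * cis t))%C 0 (2 * PI) = (RtoC (2 * PI) * g 0)%C).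
  { assert (E : (Ci * CInt (fun t => g (r * cis t)) 0 (2 * PI) = RtoC (2 * PI) * Ci * g 0)%C).
    { rewrite <- (cauchy_formula g r 0 Hr); [|rewrite Cmod_0; easy|intros; apply Hg; lra].
      rewrite <- CInt_scal by (lra || easy).
      apply CInt_ext; [lra|]. intros t _. pose proof (cis_neq_0 t).
      assert (RtoC r <> 0) by (intros E; apply RtoC_inj in E; lra).
      now field. }
    replace (CInt (fun t => g (r * cis t))%C 0 (2 * PI))
      with (- Ci * (Ci * CInt (fun t => g (r * cis t)) 0 (2 * PI)))%C.
    - rewrite E. replace (- Ci * (RtoC (2 * PI) * Ci * g 0))%C
        with (- (Ci * Ci) * (RtoC (2 * PI) * g 0))%C by ring.
      replace (Ci * Ci)%C with (RtoC (-1)); [ring|].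
      unfold Ci, Cmult, RtoC; simpl; f_equal; ring.
    - replace (- Ci * (Ci * CInt (fun t => g (r * cis t)) 0 (2 * PI)))%C
        with (- (Ci * Ci) * CInt (fun t => g (r * cis t)) 0 (2 * PI))%C by ring.
      replace (Ci * Ci)%C with (RtoC (-1)); [ring|].
      unfold Ci, Cmult, RtoC; simpl; f_equal; ring. }
  assert (H : 0 < RInt (fun t => Im (g (r * cis t)%C)) 0 (2 * PI)).
  { apply RInt_gt_0; [lra| |].
    - intros t _. apply Hpos. rewrite Cmod_circle; lra.
    - intros t Ht. apply (tends_Im (locally t) (fun t => g (r * cis t)%C)), Hc, Ht. }
  change (0 < Im (CInt (fun t => g (r * cis t)%C) 0 (2 * PI))) in H.
  rewrite E, im_scal_l in H. nra.
Qed.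

Lemma Im_inv (w : C) : w <> 0 -> Im (/ w) = - Im w / Cmod w ^ 2.
Proof.
  intros Hw. destruct w as [x y].
  rewrite Cmod2_alt. reflexivity.
Qed.

Lemma removable_of_Im_bounded (omega : C -> C) (a : C) (rho M : R) : 0 < rho ->
  (forall k : C, punctured_disc a rho k -> cdiff omega k) ->
  (forall k : C, punctured_disc a rho k -> Im (omega k) <= M) ->
  exists g : C -> C, (forall k, Defs.disc a rho k -> cdiff g k) /\
            (forall k, punctured_disc a rho k -> g k = omega k).
Proof.
  intros Hrho Hd HM.
  (* M + 1 rather than M keeps omega - c at distance at least 1 from 0, which gives the bound 1 that
     [riemann_removable] asks for. *)
  set (c := (Ci * RtoC (M + 1))%C).
  set (f := (fun w => / (omega (a + w) - c))%C).
  assert (Hin : forall w, 0 < Cmod w < rho -> punctured_disc a rho (a + w)%C).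
  { intros w Hw. unfold punctured_disc. now replace (a + w - a)%C with w by ring. }
  assert (Him : forall w, 0 < Cmod w < rho -> Im (omega (a + w)%C - c) <= -1).
  { intros w Hw. specialize (HM _ (Hin w Hw)).
    replace (Im (omega (a + w)%C - c)) with (Im (omega (a + w)%C) - (M + 1)); [lra|].
    unfold c. simpl. unfold Im. ring. }
  assert (Hge : forall w, 0 < Cmod w < rho -> 1 <= Cmod (omega (a + w) - c)%C).
  { intros w Hw. specialize (Him w Hw). pose proof (im_le_Cmod (omega (a + w) - c)%C) as H.
    rewrite Rabs_left1 in H by lra. lra. }
  assert (Hnz : forall w, 0 < Cmod w < rho -> (omega (a + w) - c)%C <> 0).
  { intros w Hw. apply Cmod_gt_0. specialize (Hge w Hw). lra. }
  assert (Hf : forall w, 0 < Cmod w < rho -> cdiff f w).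
  { intros w Hw. apply (cdiff_inv (fun w => omega (a + w) - c)%C); [now apply Hnz|].
    apply cdiff_minus; [|apply cdiff_const]. apply cdiff_shift, Hd, Hin, Hw. }
  destruct (riemann_removable f rho Hrho Hf) as (g & Hg & Egf).
  { intros w Hw. unfold f. rewrite Cmod_inv by now apply Hnz.
    rewrite <- Rinv_1. apply Rinv_le_contravar; [lra|now apply Hge]. }
  assert (Ipos : forall w, 0 < Cmod w < rho -> 0 < Im (g w)).
  { intros w Hw. rewrite Egf by (apply Cmod_gt_0; lra). unfold f.
    rewrite Im_inv by now apply Hnz. specialize (Him w Hw). specialize (Hge w Hw).
    apply Rdiv_lt_0_compat; [lra|]. apply pow_lt; lra. }
  assert (I0 : 0 < Im (g 0)) by now apply (mean_value_Im_pos g rho).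
  assert (gnz : forall w, Cmod w < rho -> g w <> 0).
  { intros w Hw E.
    assert (H : 0 < Im (g w)).
    { destruct (Ceq_dec w 0) as [->|n]; [easy|]. apply Ipos. split; [now apply Cmod_gt_0|easy]. }
    rewrite E in H. simpl in H. lra. }
  exists (fun k => / g (- a + k) + c)%C. split.
  - intros k Hk. unfold Defs.disc in Hk. replace (k - a)%C with (- a + k)%C in Hk by ring.
    apply cdiff_plus; [|apply cdiff_const].
    apply (cdiff_inv (fun k => g (- a + k))%C); [now apply gnz|].
    now apply cdiff_shift, Hg.
  - intros k Hk. assert (Hk' : 0 < Cmod (- a + k) < rho)
      by (unfold punctured_disc in Hk; now replace (k - a)%C with (- a + k)%C in Hk by ring).
    rewrite Egf by (apply Cmod_gt_0; lra). unfold f.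
    specialize (Hnz _ Hk'). replace (a + (- a + k))%C with k in * by ring. now field.
Qed.

(** * Exclusion of poles and essential singularities *)

Theorem theorem2 (Omega : C -> Prop) (omega : C -> C)
  (HOmega : @open C_UniformSpace Omega)
  (Hhol : holomorphic_on Omega omega)
  (Him : forall k : C, Omega k -> Im (omega k) <= Rabs (Im k)) :
  forall a : C,
    ~ Omega a ->
    (exists rho : R, 0 < rho /\
       forall k : C, 0 < Cmod (k - a)%C < rho -> Omega k) ->
    ~ is_pole Omega omega a /\ ~ is_essential Omega omega a.
Proof.
  intros a Ha (rho & Hrho & HO).
  (* Cmod (k - a) < rho gives Rabs (Im k) <= Rabs (Im a) + rho, a constant bound. *)
  destruct (removable_of_Im_bounded omega a rho (Rabs (Im a) + rho)) as (g & Hg & Eg); [easy| | |].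
  { intros k Hk. now apply cdiff_ex_derive, Hhol, HO. }
  { intros k Hk. eapply Rle_trans; [now apply Him, HO|].
    replace (Im k) with (Im a + Im (k - a)%C) by (simpl; unfold Im; ring).
    eapply Rle_trans; [apply Rabs_triang|].
    pose proof (im_le_Cmod (k - a)%C). destruct Hk. lra. }
  split.
  - intros [_ Hp].
    assert (Ha' : Defs.disc a rho a).
    { unfold Defs.disc. replace (a - a)%C with (RtoC 0) by ring. now rewrite Cmod_0. }
    pose proof (cdiff_tends g a (Hg a Ha') 1 ltac:(lra)) as Hb.
    (* At a pole Cmod omega would exceed Cmod (g a) + 1 near a, whereas continuity of the extension
       g keeps it at most that. *)
    assert (Hl : @locally' C_UniformSpace a (fun z => Cmod (g a) + 1 < Cmod (omega z))).
    { apply Hp. now exists (Cmod (g a) + 1). }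
    apply locally_CP in Hb as (d1 & Hd1 & Hb). apply locally_CP in Hl as (d2 & Hd2 & Hl).
    (* The real shift a + s by half the least radius lies in all three neighbourhoods and differs
       from a. *)
    set (s := Rmin rho (Rmin d1 d2) / 2).
    assert (Hs : 0 < Rmin rho (Rmin d1 d2)) by (repeat apply Rmin_glb_lt; easy).
    assert (s1 : Rmin rho (Rmin d1 d2) <= rho) by apply Rmin_l.
    assert (s2 : Rmin rho (Rmin d1 d2) <= d1) by (eapply Rle_trans; [apply Rmin_r|apply Rmin_l]).
    assert (s3 : Rmin rho (Rmin d1 d2) <= d2) by (eapply Rle_trans; [apply Rmin_r|apply Rmin_r]).
    assert (Es : Cmod (a + s - a) = s).
    { replace (a + s - a)%C with (RtoC s) by ring. rewrite Cmod_R. apply Rabs_pos_eq. unfold s; lra. }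
    assert (Hk : punctured_disc a rho (a + s)%C) by (unfold punctured_disc; rewrite Es; unfold s; lra).
    specialize (Hb (a + s)%C ltac:(rewrite Es; unfold s; lra)).
    specialize (Hl (a + s)%C ltac:(rewrite Es; unfold s; lra)).
    rewrite <- (Eg _ Hk) in Hl.
    specialize (Hl ltac:(apply Cmod_minus_gt_0; rewrite Es; unfold s; lra)).
    pose proof (Cmod_triangle_rev (g (a + s)%C) (g a)). lra.
  (* An essential singularity is by definition not removable, and g shows that a is removable. *)
  - intros (Hi & Hr & _). apply Hr. split; [easy|].
    exists rho, g. split; [easy|]. split.
    + intros k Hk. now apply cdiff_ex_derive, Hg.
    + intros k Hk. split; [now apply HO|now apply Eg].
Qed.
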